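(* Let $\Gamma \leq \mathrm{Diff}_{+}(I)$ be a finitely generated subgroup such that every non-identity element of $\Gamma$ has finitely many fixed points. Then either $\Gamma$ is isomorphic (as a group) to a subgroup of $\mathrm{Aff}_{+}(\mathbb{R})^n$ for some $n\geq 1$, or $\Gamma$ has infinite girth.
   Context: $I=[0,1]$, and $\mathrm{Diff}_{+}(I)$ is the group of orientation preserving $C^1$-diffeomorphisms of $I$. $\mathrm{Aff}_{+}(\mathbb{R})$ is the group of all maps $x\mapsto ax+b$ of $\mathbb{R}$ with $a>0$, $b\in\mathbb{R}$; $\mathrm{Aff}_{+}(\mathbb{R})^n$ is its $n$-fold direct product. The girth of a graph is the length of a shortest cycle in it (equal to $\infty$ if there is no cycle). The girth of a finitely generated group $\Gamma$ is $$girth(\Gamma)=\sup\{girth(\mathcal{G}(\Gamma,S)) : \langle S\rangle=\Gamma,\ |S|<\infty\},$$ where $\mathcal{G}(\Gamma,S)$ is the Cayley graph of $\Gamma$ with respect to the finite generating set $S$. ''Either ... or'' is inclusive. *)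

(* Defs.v *)
From HB Require Import structures.
From mathcomp Require Import all_boot all_order all_algebra.
From mathcomp Require Import all_classical all_reals all_analysis.
Import Order.TTheory GRing.Theory Num.Theory.
Import numFieldNormedType.Exports.

Set Implicit Arguments.
Unset Strict Implicit.
Unset Printing Implicit Defensive.

Local Open Scope classical_set_scope.
Local Open Scope ring_scope.

(* The group of all self-bijections of T, with (g * h) x = g (h x). *)
Record bij_group (T : Type) := BijGroup {
  bij_fun :> T -> T;
  bij_inv : T -> T;
  bij_funK : cancel bij_fun bij_inv;
  bij_invK : cancel bij_inv bij_fun
}.

Section BijGroup.
Variable T : Type.
Implicit Types g h : bij_group T.

Lemma bij_groupP g h : (forall x, g x = h x) -> g = h.
Proof.
case: g h => [f f' fK f'K] [k k' kK k'K] /= /funext fk.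
have f'k' : f' = k' by apply/funext => x; rewrite -{1}[x]k'K -fk fK.
by subst; congr BijGroup; exact: Prop_irrelevance.
Qed.

Definition bij_one : bij_group T := @BijGroup T id id (fun=> erefl) (fun=> erefl).

Definition bij_mul g h : bij_group T :=
  BijGroup (can_comp (@bij_funK _ g) (@bij_funK _ h))
           (can_comp (@bij_invK _ h) (@bij_invK _ g)).

Definition bij_V g : bij_group T := BijGroup (@bij_invK _ g) (@bij_funK _ g).

Fact bij_mulA : associative bij_mul.
Proof. by move=> f g h; exact: bij_groupP. Qed.
Fact bij_mul1g : left_id bij_one bij_mul.
Proof. by move=> g; exact: bij_groupP. Qed.
Fact bij_mulg1 : right_id bij_one bij_mul.
Proof. by move=> g; exact: bij_groupP. Qed.
Fact bij_mulVg : left_inverse bij_one bij_V bij_mul.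
Proof. by move=> g; apply: bij_groupP => x /=; exact: bij_funK. Qed.
Fact bij_mulgV : right_inverse bij_one bij_V bij_mul.
Proof. by move=> g; apply: bij_groupP => x /=; exact: bij_invK. Qed.

HB.instance Definition _ := gen_eqMixin (bij_group T).
HB.instance Definition _ := gen_choiceMixin (bij_group T).
HB.instance Definition _ := isGroup.Build (bij_group T)
  bij_mulA bij_mul1g bij_mulg1 bij_mulVg bij_mulgV.

End BijGroup.

Definition subgroup (gT : groupType) (G : set gT) : Prop := group_closed (mem G).

Definition generated (gT : groupType) (S : set gT) : set gT :=
  smallest (@subgroup gT) S.

Definition finite_generating_set (gT : groupType) (G S : set gT) : Prop :=
  finite_set S /\ generated S = G.

Definition finitely_generated (gT : groupType) (G : set gT) : Prop :=
  exists S : set gT, finite_generating_set G S.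

Definition isomorphic (gT hT : groupType) (G : set gT) (H : set hT) : Prop :=
  exists f : gT -> hT,
    {in G &, {morph f : x y / (x * y)%g}} /\ set_bij G H f.

(* Cycles have at least three, pairwise distinct, vertices; the infimum of the
   empty set is +oo. *)
Definition graph_girth (R : realType) (V : eqType) (e : rel V) : \bar R :=
  ereal_inf [set ((size c)%:R : R)%:E | c in [set c | (2 < size c)%N /\ ucycle e c]].
Arguments graph_girth R {V} e.

(* The Cayley graph as a simple undirected graph with vertex set G. *)
Definition cayley_graph (gT : groupType) (G S : set gT) : rel gT :=
  fun x y => `[< [/\ G x, G y, x != y &
                     exists2 s, S s & (y = x * s \/ x = y * s)%g ] >].

Definition group_girth (R : realType) (gT : groupType) (G : set gT) : \bar R :=
  ereal_sup [set graph_girth R (cayley_graph G S) |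
             S in [set S | finite_generating_set G S]].
Arguments group_girth R {gT} G.

Definition unitI (R : realType) : set R := `[0, 1].
Arguments unitI : clear implicits.

(* The limit is taken over points y != x of [0, 1], hence is one-sided at the
   endpoints. *)
Definition C1_unitI (R : realType) (f : unitI R -> unitI R) : Prop :=
  exists df : unitI R -> R, continuous df /\
    forall x : unitI R,
      (\val (f y) - \val (f x)) / (\val y - \val x) @[y --> x^'] --> df x.

Definition Diff_plus (R : realType) : set (bij_group (unitI R)) :=
  [set g : bij_group (unitI R) | [/\ C1_unitI g, C1_unitI (g^-1)%g &
               forall x y : unitI R, \val x < \val y -> \val (g x) < \val (g y)]].

Definition Aff_plus (R : realType) : set (bij_group R) :=
  [set g : bij_group R | exists a b : R, 0 < a /\ forall x, g x = a * x + b].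

Definition Aff_plus_pow (R : realType) (n : nat)
    : set {ffun 'I_n -> bij_group R} :=
  [set g | forall i, Aff_plus (g i)].
Arguments Aff_plus_pow : clear implicits.
Arguments Aff_plus : clear implicits.
Arguments Diff_plus : clear implicits.

Lemma subgroup_Aff_plus (R : realType) : subgroup (Aff_plus R).
Proof.
split; first by apply/mem_set; exists 1, 0; split=> // x; rewrite mul1r addr0.
move=> g h /set_mem[a [b [a0 gE]]] /set_mem[c [d [c0 hE]]]; apply/mem_set.
exists (a / c), (b - a / c * d); split; first exact: divr_gt0.
move=> x /=; set y := bij_inv h x.
have -> : x = c * y + d by rewrite -hE /y bij_invK.
by rewrite gE mulrDr mulrA divfK ?gt_eqF// -[RHS]addrA [X in _ = _ + X]addrC subrK.
Qed.

Lemma subgroup_Aff_plus_pow (R : realType) (n : nat) : subgroup (Aff_plus_pow R n).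
Proof.
have [A1 AV] := subgroup_Aff_plus R; split.
  by apply/mem_set => i; rewrite ffunE; exact/set_mem.
move=> g h /set_mem Ag /set_mem Ah; apply/mem_set => i.
by rewrite !ffunE; apply/set_mem/AV; exact/mem_set.
Qed.

Lemma C1_unitI_continuous (R : realType) (f : unitI R -> unitI R) :
  C1_unitI f -> continuous f.
Proof.
case=> df [_ dfP] x.
have valc : continuous (\val : unitI R -> R) by exact: initial_continuous.
apply: (@continuous_comp_initial (unitI R) _ R \val f _ x) => {}x.
apply/continuous_withinNx.
have vx0 : \val y - \val x @[y --> x^'] --> (0 : R).
  rewrite -(subrr (\val x)); apply: cvgB; last exact: cvg_cst.
  exact/continuous_withinNx/valc.
have := cvgD (cvg_cst (\val (f x))) (cvgM (dfP x) vx0).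
rewrite mulr0 addr0 => lim; apply: cvg_trans (lim _ _ _); apply: near_eq_cvg.
near=> y; rewrite fctE /= divfK ?subrKC// subr_eq0 (inj_eq val_inj).
by near: y; exact: nbhs_dnbhs_neq.
Unshelve. all: by end_near. Qed.

Lemma C1_unitI_comp (R : realType) (f g : unitI R -> unitI R) :
  injective g -> C1_unitI f -> C1_unitI g -> C1_unitI (f \o g).
Proof.
move=> gI [df [dfc dfP]] Cg; have gc := C1_unitI_continuous Cg.
have [dg [dgc dgP]] := Cg.
exists (fun x => df (g x) * dg x); split=> [x|x].
  exact: cvgM (continuous_comp (gc x) (dfc (g x))) (dgc x).
have gx : g @ x^' --> (g x)^'.
  by apply: continuous_injective_withinNx => [|y /gI//]; exact: gc.
have lim := cvgM (cvg_comp _ _ gx (dfP (g x))) (dgP x).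
apply: cvg_trans (lim _).
apply: near_eq_cvg; near=> y; rewrite /= mulrA divfK//.
rewrite subr_eq0 (inj_eq val_inj) (inj_eq gI).
by near: y; exact: nbhs_dnbhs_neq.
Unshelve. all: by end_near. Qed.

Lemma C1_unitI_id (R : realType) : @C1_unitI R id.
Proof.
exists (fun=> 1); split=> [|x]; first exact: cst_continuous.
apply: cvg_near_cst; near=> y.
rewrite /= divff// subr_eq0 (inj_eq val_inj).
by near: y; exact: nbhs_dnbhs_neq.
Unshelve. all: by end_near. Qed.

Lemma subgroup_Diff_plus (R : realType) : subgroup (Diff_plus R).
Proof.
split; first by apply/mem_set; split=> //; exact: C1_unitI_id.
move=> g h /set_mem[g1 g2 g3] /set_mem[h1 h2 h3]; apply/mem_set; split=> /=.
- by apply: (@C1_unitI_comp _ g _) => //; exact: can_inj (@bij_invK _ h).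
- by apply: (@C1_unitI_comp _ h _) => //; exact: can_inj (@bij_invK _ g).
move=> x y xy; apply: g3; rewrite /= ltNge; apply: contraTN xy => yx.
rewrite -leNgt -[leLHS](congr1 val (bij_invK h y)) -[leRHS](congr1 val (bij_invK h x)).
move: yx; rewrite !le_eqVlt => /orP[/eqP/val_inj->|/h3->]; rewrite ?eqxx ?orbT//.
Qed.

(* Main.v *)
Require Import Defs.
From HB Require Import structures.
From mathcomp Require Import all_boot all_order all_algebra.
From mathcomp Require Import all_classical all_reals all_analysis.
From mathcomp Require Import lra zify.
Set Implicit Arguments.
Unset Strict Implicit.
Unset Printing Implicit Defensive.
Import Order.TTheory GRing.Theory Num.Theory.
Local Open Scope classical_set_scope.
Local Open Scope ring_scope.

(* Extend the elements of G to increasing bijections of R.  Since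
   fixed points do not accumulate at 0, comparing germs at 0+ makes G a
   bi-ordered group; write a << e when every power of a is smaller than e.

   If no u > 1 is minimal for <<, there are arbitrarily long chains
   e_0 << e_1 << ... << e_M.  Starting from h = e_0, the replacement of h by
   h^-j e_k h^-j keeps germs positive (as h << e_k) but reverses, for j large,
   the direction in which h moves points on any prescribed intervals away from
   0.  Iterating produces elements that alternately push points up and down on
   a long sequence of intervals going down to 0, with spacing as large as
   desired compared with a given finite set of elements.  Two such elements P
   and Q with interlaced intervals play ping-pong: no nontrivial short word
   P^k1 s1 Q^k2 s2 P^k3 ..., with the s_i in the finite set, is trivial, and
   replacing generators t_i by P^(a_i) t_i Q^(a_i) with widely separated
   exponents a_i yields generating sets without short relations.

   If u > 1 is minimal for <<, the elements bounded by powers of u form an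
   Archimedean normal subgroup D, which Hoelder's theorem embeds in R by phi.
   Let p be the first point of (0, 1] fixed by G.  Then D acts freely on (0, p)
   with unbounded orbits.  If phi(D) is dense, it develops (0, p) to R, and G
   acts on R by affine maps.  If phi(D) is discrete, it is central, so that G
   acts freely on (0, p), hence is itself Archimedean and embeds in R. *)

(** * Groups ordered by their germs at 0 *)

Record germ_action (R : realType) (gT : groupType) := GermAction {
  act :> gT -> R -> R;
  act1 : forall x, act 1%g x = x;
  actM : forall g h x, act (g * h)%g x = act g (act h x);
  act_homo : forall g x y, x < y -> act g x < act g y;
  act_at0 : forall g, act g 0 = 0;
  act_at1 : forall g, act g 1 = 1;
  act_germ : forall g, g != 1%g ->
    exists2 d, 0 < d & forall x, 0 < x < d -> act g x != x
}.

Section GermAction.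
Variables (R : realType) (gT : groupType) (act : germ_action R gT).
Implicit Types (g h a b c e : gT) (x y z : R) (n : nat).

Lemma actK g : cancel (act g) (act g^-1%g).
Proof. by move=> x; rewrite -actM mulVg act1. Qed.

Lemma actVK g : cancel (act g^-1%g) (act g).
Proof. by move=> x; rewrite -actM mulgV act1. Qed.

Lemma act_lt g x y : (act g x < act g y) = (x < y).
Proof.
apply/idP/idP; last exact: act_homo.
by move=> /(act_homo act g^-1%g); rewrite !actK.
Qed.

Lemma act_le g x y : (act g x <= act g y) = (x <= y).
Proof. by rewrite !leNgt act_lt. Qed.

Lemma act_gt0 g x : (0 < act g x) = (0 < x).
Proof. by rewrite -{1}(act_at0 act g) act_lt. Qed.

Lemma actV_lt g x y : (act g^-1%g x < y) = (x < act g y).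
Proof. by rewrite -(act_lt g) actVK. Qed.

Lemma lt_actV g x y : (x < act g^-1%g y) = (act g x < y).
Proof. by rewrite -(act_lt g) actVK. Qed.

Lemma actV_le g x y : (act g^-1%g x <= y) = (x <= act g y).
Proof. by rewrite -(act_le g) actVK. Qed.

Lemma le_actV g x y : (x <= act g^-1%g y) = (act g x <= y).
Proof. by rewrite -(act_le g) actVK. Qed.

Lemma act_eqV g x : act g x = x -> act g^-1%g x = x.
Proof. by move=> gx; rewrite -{1}gx actK. Qed.

Lemma actXS g n x : act (g ^+ n.+1)%g x = act g (act (g ^+ n)%g x).
Proof. by rewrite expgS actM. Qed.

Lemma act_sup g (A : set R) : A !=set0 -> has_ubound A ->
  (forall x, A x -> A (act g x)) -> (forall x, A x -> A (act g^-1%g x)) ->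
  act g (sup A) = sup A.
Proof.
move=> A0 Au gA gVA; apply/eqP; rewrite eq_le; apply/andP; split.
  rewrite -le_actV; apply: ge_sup => // x /gA /(ub_le_sup Au).
  by rewrite -le_actV.
by apply: ge_sup => // x /gVA /(ub_le_sup Au); rewrite actV_le.
Qed.

Lemma act_inf g (A : set R) : A !=set0 -> has_lbound A ->
  (forall x, A x -> A (act g x)) -> (forall x, A x -> A (act g^-1%g x)) ->
  act g (inf A) = inf A.
Proof.
move=> A0 Al gA gVA; apply/eqP; rewrite eq_le; apply/andP; split.
  by apply: lb_le_inf => // x /gVA /(ge_inf Al); rewrite le_actV.
rewrite -actV_le; apply: lb_le_inf => // x /gA /(ge_inf Al).
by rewrite actV_le.
Qed.

(* The Knaster-Tarski argument: no continuity is needed. *)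
Lemma act_fixpoint g x y : x <= y -> x <= act g x -> act g y <= y ->
  exists2 z, x <= z <= y & act g z = z.
Proof.
move=> xy gx gy; pose A := [set z | x <= z <= y /\ z <= act g z].
have Ax : A x by split; rewrite // lexx.
have Au : has_ubound A by exists y => z [/andP[]].
have yA : ubound A y by move=> z [/andP[]].
have supA : x <= sup A <= y.
  by rewrite (ub_le_sup Au Ax) ge_sup//; exists x.
exists (sup A) => //; have le1 : sup A <= act g (sup A).
  apply: ge_sup; first by exists x.
  by move=> z Az; rewrite (le_trans Az.2)// act_le ub_le_sup.
apply/eqP; rewrite eq_le le1 andbT; apply: ub_le_sup => //; split.
  case/andP: supA => xs sy; rewrite (le_trans xs le1)/=.
  by rewrite (le_trans _ gy)// act_le.
by rewrite act_le.
Qed.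

(** Points moved in opposite directions enclose a fixed point by [act_fixpoint]; if the one moved
    down comes first, the inverse is used. *)
Lemma act_const_sign g (lo hi : R) :
  (forall x, lo < x < hi -> act g x != x) ->
  (forall x, lo < x < hi -> x < act g x) \/
  (forall x, lo < x < hi -> act g x < x).
Proof.
move=> nofix.
have key h x y : (forall x, lo < x < hi -> act h x != x) ->
    lo < x -> x <= y -> y < hi -> x < act h x -> act h y < y -> False.
  move=> nf lx xy yh hx hy.
  have [z /andP[xz zy] /eqP] := act_fixpoint xy (ltW hx) (ltW hy).
  by apply/negP/nf; rewrite (lt_le_trans lx xz) (le_lt_trans zy yh).
have nofixV x : lo < x < hi -> act g^-1%g x != x.
  by move=> /nofix; apply: contraNneq => /act_eqV; rewrite invgK => ->.
have [[x [xI gx]]|npos] := pselect (exists x, lo < x < hi /\ x < act g x); last first.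
  right=> x xI; have := nofix x xI; rewrite neq_lt => /orP[//|gx].
  by case: npos; exists x.
left=> y yI; have := nofix y yI; rewrite neq_lt => /orP[gy|//]; exfalso.
case/andP: xI => lx xh; case/andP: yI => ly yh.
have [xy|/ltW yx] := leP x y; first exact: (key g x y).
by apply: (key g^-1%g y x) => //; rewrite ?lt_actV ?actV_lt.
Qed.

(** Otherwise the supremum s of the orbit lies in [r, l], so s < g s; some iterate exceeds g^-1 s,
    and the next one exceeds s. *)
Lemma act_escape g r l : (forall x, r <= x <= l -> x < act g x) ->
  exists n, l < act (g ^+ n)%g r.
Proof.
move=> up; apply: contrapT => stay.
have le_l n : act (g ^+ n)%g r <= l.
  by rewrite leNgt; apply/negP => ?; apply: stay; exists n.
pose A := range (fun n => act (g ^+ n)%g r).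
have Au : has_ubound A by exists l => _ [n _ <-].
have A0 : A !=set0 by exists r, 0%N => //; rewrite expg0 act1.
have rs : r <= sup A by apply: ub_le_sup => //; exists 0%N => //; rewrite expg0 act1.
have sl : sup A <= l by apply: ge_sup => // _ [n _ <-].
have /up : r <= sup A <= l by rewrite rs sl.
rewrite -actV_lt => /(sup_gt A0)[_ [n _ <-]].
by rewrite actV_lt -actXS ltNge ub_le_sup//; exists n.+1.
Qed.

(** * Germs at 0 from the right and their bi-invariant order *)

Definition near0 (P : R -> Prop) := exists2 d, 0 < d & forall x, 0 < x < d -> P x.

Lemma near0_and P Q : near0 P -> near0 Q -> near0 (fun x => P x /\ Q x).
Proof.
move=> [d d0 Pd] [d' d'0 Qd]; exists (Num.min d d').
  by rewrite lt_min d0.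
by move=> x; rewrite lt_min => /and3P[x0 xd xd']; split; [apply: Pd|apply: Qd]; rewrite x0.
Qed.

Lemma near0_imp (P Q : R -> Prop) : (forall x, 0 < x -> P x -> Q x) -> near0 P -> near0 Q.
Proof.
move=> PQ [d d0 Pd]; exists d => // x /andP[x0 xd].
by apply: PQ => //; apply: Pd; rewrite x0.
Qed.

Lemma near0_act g P : near0 P -> near0 (fun x => P (act g x)).
Proof.
move=> [d d0 Pd]; exists (act g^-1%g d); first by rewrite act_gt0.
by move=> x /andP[x0 xd]; apply: Pd; rewrite act_gt0 x0 -lt_actV.
Qed.

Lemma near0_ex P : near0 P -> exists2 x, 0 < x & P x.
Proof.
by move=> [d d0 Pd]; exists (d / 2); [lra|apply: Pd; lra].
Qed.

Definition germ_lt g h := near0 (fun x => act g x < act h x).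
Definition germ_le g h := near0 (fun x => act g x <= act h x).

Lemma germ_ltW g h : germ_lt g h -> germ_le g h.
Proof. by apply: near0_imp => x _ /ltW. Qed.

Lemma germ_lexx g : germ_le g g.
Proof. by exists 1. Qed.

Lemma germ_le_trans h g k : germ_le g h -> germ_le h k -> germ_le g k.
Proof. by move=> gh /(near0_and gh); apply: near0_imp => x _ [] /le_trans; exact. Qed.

Lemma germ_lt_le_trans h g k : germ_lt g h -> germ_le h k -> germ_lt g k.
Proof. by move=> gh /(near0_and gh); apply: near0_imp => x _ [] /lt_le_trans; exact. Qed.

Lemma germ_le_lt_trans h g k : germ_le g h -> germ_lt h k -> germ_lt g k.
Proof. by move=> gh /(near0_and gh); apply: near0_imp => x _ [] /le_lt_trans; exact. Qed.

Lemma germ_le_ltF g h : germ_le g h -> germ_lt h g -> False.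
Proof.
move=> gh /(near0_and gh)/near0_ex[x _ [xle]]; by rewrite ltNge xle.
Qed.

(** Unless it is 1, h^-1 g moves all points near 0, and all in the same direction. *)
Lemma germ_total g h : [\/ g = h, germ_lt g h | germ_lt h g].
Proof.
have [->|neq] := pselect (g = h); first by constructor 1.
have /(act_germ act)[d d0 nofix] : (h^-1 * g)%g != 1%g.
  by apply/eqP => /(congr1 (fun k => h * k)%g); rewrite mulVKg mulg1.
have [up|down] := act_const_sign nofix.
  by constructor 3; exists d => // x /up; rewrite actM -(act_lt h) actVK.
by constructor 2; exists d => // x /down; rewrite actM -(act_lt h) actVK.
Qed.

Lemma germ_leVgt g h : germ_le g h \/ germ_lt h g.
Proof.
have [->|/germ_ltW|] := germ_total g h; [left; exact: germ_lexx|by left|by right].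
Qed.

Lemma germ_leM g h g' h' : germ_le g h -> germ_le g' h' -> germ_le (g * g')%g (h * h')%g.
Proof.
move=> /(near0_act g') gh /(near0_and gh); apply: near0_imp => x _ [le1 le2].
by rewrite !actM (le_trans le1)// act_le.
Qed.

Lemma germ_ltMl g h k : germ_lt g h -> germ_lt (k * g)%g (k * h)%g.
Proof. by apply: near0_imp => x _; rewrite !actM act_lt. Qed.

Lemma germ_ltMr g h k : germ_lt g h -> germ_lt (g * k)%g (h * k)%g.
Proof. by move=> /(near0_act k); apply: near0_imp => x _; rewrite !actM. Qed.

Lemma germ_leX g h n : germ_le g h -> germ_le (g ^+ n)%g (h ^+ n)%g.
Proof.
move=> gh; elim: n => [|n IH]; first by rewrite !expg0; exact: germ_lexx.
by rewrite !expgS; exact: germ_leM.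
Qed.

Lemma germ_leV g h : germ_le g h -> germ_le h^-1%g g^-1%g.
Proof.
move=> gh.
have := germ_leM (germ_leM (germ_lexx h^-1%g) gh) (germ_lexx g^-1%g).
by rewrite mulVg mul1g mulgK.
Qed.

Lemma germ_leV1 g : germ_le 1%g g -> germ_le g^-1%g 1%g.
Proof. by move=> /germ_leV; rewrite invg1. Qed.

Lemma germ_le1V g : germ_le g 1%g -> germ_le 1%g g^-1%g.
Proof. by move=> /germ_leV; rewrite invg1. Qed.

Lemma germ_conj_le c g h : germ_le g h -> germ_le (c * g * c^-1)%g (c * h * c^-1)%g.
Proof. by move=> gh; do 2?apply: germ_leM => //; exact: germ_lexx. Qed.

Lemma germ_conj_lt c g h : germ_lt g h -> germ_lt (c * g * c^-1)%g (c * h * c^-1)%g.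
Proof. by move=> gh; apply/germ_ltMr/germ_ltMl. Qed.

Lemma germ_ltV g h : germ_lt g h -> germ_lt h^-1%g g^-1%g.
Proof.
move=> /(germ_ltMl h^-1%g)/(germ_ltMr g^-1%g).
by rewrite mulVg mul1g mulgK.
Qed.

Lemma conj_exp c g n : (c * g ^+ n * c^-1 = (c * g * c^-1) ^+ n)%g.
Proof.
elim: n => [|n IH]; first by rewrite !expg0 mulg1 mulgV.
by rewrite !expgS -IH !mulgA mulgVK.
Qed.

Lemma germ_ge1_X g n : germ_le 1%g g -> germ_le 1%g (g ^+ n)%g.
Proof. by move=> /(germ_leX n); rewrite expg1n. Qed.

(* a is infinitely small with respect to e in the ordered group of germs. *)
Definition germ_ll a e := forall n, germ_lt (a ^+ n)%g e /\ germ_lt (a^-1 ^+ n)%g e.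

Lemma germ_ll_lt a e : germ_ll a e -> germ_lt a e.
Proof. by move=> /(_ 1%N)[]; rewrite expg1. Qed.

Lemma germ_ll_gt1 a e : germ_ll a e -> germ_lt 1%g e.
Proof. by move=> /(_ 0%N)[]; rewrite expg0. Qed.

Lemma germ_ll_le a e e' : germ_ll a e -> germ_le e e' -> germ_ll a e'.
Proof. by move=> ae ee' n; have [] := ae n; split; exact: germ_lt_le_trans ee'. Qed.

Lemma germ_llV a e : germ_ll a e -> germ_ll a^-1%g e.
Proof. by move=> ae n; rewrite invgK; have [] := ae n. Qed.

Lemma germ_ll_dom a e :
  germ_le 1%g a -> (forall n, germ_lt (a ^+ n)%g e) -> germ_ll a e.
Proof.
move=> a1 ae n; split=> //; apply: germ_le_lt_trans (ae n).
by apply: germ_leX; apply: (germ_le_trans _ a1); exact: germ_leV1.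
Qed.

Lemma germ_ll_abs a e : germ_ll a e ->
  exists c, [/\ germ_le 1%g c, germ_ll c e, germ_le a c & germ_le a^-1%g c].
Proof.
move=> ae; have [a1|/germ_ltW a1] := germ_leVgt 1%g a.
  exists a; split=> //; first exact: germ_lexx.
  by apply: (germ_le_trans _ a1); exact: germ_leV1.
exists a^-1%g; split; [exact: germ_le1V|exact: germ_llV| |exact: germ_lexx].
by apply: (germ_le_trans a1); exact: germ_le1V.
Qed.

(** If m is the larger of the two absolute values, the n-th powers of ab and of its inverse are at
    most m^(2n), hence below e. *)
Lemma germ_llM a b e : germ_ll a e -> germ_ll b e -> germ_ll (a * b)%g e.
Proof.
move=> /germ_ll_abs[c [c1 ce ac acV]] /germ_ll_abs[d [d1 de bd bdV]].
have [m [m1 me cm dm]] : exists m, [/\ germ_le 1%g m, germ_ll m e,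
    germ_le c m & germ_le d m].
  have [cd|/germ_ltW dc] := germ_leVgt c d.
    by exists d; split=> //; exact: germ_lexx.
  by exists c; split=> //; exact: germ_lexx.
have powm n : germ_lt ((m * m) ^+ n)%g e.
  by rewrite -expg2 -expgnA; have [] := me (2 * n)%N.
move=> n; split; apply: germ_le_lt_trans (powm n); apply: germ_leX.
  by apply: germ_leM; [apply: germ_le_trans cm|apply: germ_le_trans dm].
by rewrite invgM; apply: germ_leM; [apply: germ_le_trans dm|apply: germ_le_trans cm].
Qed.

Lemma germ_llX a e n : germ_ll a e -> germ_ll (a ^+ n)%g e.
Proof.
move=> ae; elim: n => [|n IH]; last by rewrite expgS; exact: germ_llM.
by move=> n; rewrite expg0 invg1 expg1n; split; exact: germ_ll_gt1 ae.
Qed.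

End GermAction.

(** * Elements oscillating near 0 *)

Section Levels.
Variables (R : realType) (gT : groupType) (act : germ_action R gT).
Implicit Types (g h p e f : gT) (x y z : R) (l r : nat -> R) (s b : bool) (k m n : nat).

(** The interval [r, l] is pushed off itself, upwards if [s] holds and downwards otherwise. *)
Definition crosses p s (r l : R) := if s then l < act p r else act p l < r.

Lemma crossesV p s (r l : R) : crosses p s r l -> crosses p^-1%g (~~ s) r l.
Proof. by case: s; rewrite /crosses/= ?lt_actV ?actV_lt. Qed.

Lemma crossesX p s (r l : R) n : r <= l -> crosses p s r l -> crosses (p ^+ n.+1)%g s r l.
Proof.
move=> rl; elim: n => [|n IH]; first by rewrite expg1.
move=> ps; have {IH} := IH ps; move: ps; case: s; rewrite /crosses => lt1 lt2; rewrite actXS.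
  by rewrite (lt_trans lt1)// act_lt (le_lt_trans rl).
by rewrite (lt_trans _ lt1)// act_lt (lt_le_trans lt2).
Qed.

(** If h r > l, then h^-1 l < r, so e h^-1 l < e r <= l < h r; applying h^-1 gives the downward
    crossing. The other direction is symmetric. *)
Lemma crosses_flip h e s (r l : R) : act e r <= l -> r <= act e l ->
  crosses h s r l -> crosses (h^-1 * e * h^-1)%g (~~ s) r l.
Proof.
move=> er el; case: s; rewrite /crosses/= !actM => cr.
  rewrite actV_lt (lt_trans _ cr)// (lt_le_trans _ er)// act_lt actV_lt.
  exact: cr.
rewrite lt_actV (lt_trans cr)// (le_lt_trans el)// act_lt lt_actV.
exact: cr.
Qed.

Lemma crosses_power g (r l : R) : r <= l -> (forall x, r <= x <= l -> x < act g x) ->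
  exists n, crosses (g ^+ n.+1)%g true r l.
Proof.
move=> rl /act_escape[[|n]]; last by exists n.
by rewrite expg0 act1 ltNge rl.
Qed.

Lemma small_point (F : seq gT) (l : R) : 0 < l ->
  exists2 r, 0 < r & forall f, f \in F -> act f r < l.
Proof.
move=> l0; elim: F => [|f F [r r0 Fr]]; first by exists 1.
exists (Num.min r (act f^-1%g l) / 2).
  by rewrite divr_gt0// lt_min r0 act_gt0.
set x := _ / 2; have [xr xf] : x < r /\ x < act f^-1%g l.
  apply/andP; rewrite -lt_min {}/x; set m := Num.min _ _.
  have : 0 < m by rewrite lt_min r0 act_gt0.
  lra.
move=> g; rewrite in_cons => /orP[/eqP->|/Fr gr]; first by rewrite -lt_actV.
by rewrite (lt_trans _ gr)// act_lt.
Qed.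

(** Multiply h^2 < e by h^-1 on both sides. The reversed element of [crosses_flip] thus still moves
    points up near 0. *)
Lemma germ_gt1_sandwich h e : germ_ll act h e -> germ_lt act 1%g (h^-1 * e * h^-1)%g.
Proof.
move=> /(_ 2%N)[/(near0_act act h^-1%g) he _]; apply: near0_imp he => x _.
by rewrite expg2 !actM actVK act1 lt_actV.
Qed.

Variables (M : nat) (F : seq gT) (e : nat -> gT).
Hypothesis F1 : 1%g \in F.
Hypothesis Fe : forall k, (k <= M)%N -> e k \in F /\ (e k)^-1%g \in F.
Hypothesis e0 : germ_lt act 1%g (e 0%N).
Hypothesis e_ll : forall k, (k < M)%N -> germ_ll act (e k) (e k.+1).

(* The direction of P_(odd k) on block k after m steps: step m.+1 reverses it
   on all blocks k of the parity of m.+1. *)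
Definition level_sign m k := ~~ odd ((m - k)./2).

Lemma level_signS_flip m k : (k.+2 <= m)%N -> odd k = odd m.+1 ->
  level_sign m.+1 k = ~~ level_sign m k.
Proof.
rewrite /level_sign negbK => km oddk.
have -> : ((m.+1 - k)./2 = (m - k)./2.+1)%N by lia.
by rewrite /= negbK.
Qed.

Lemma level_signS_same m k : (k.+2 <= m.+1)%N -> odd k <> odd m.+1 ->
  level_sign m.+1 k = level_sign m k.
Proof.
rewrite /level_sign => km oddk.
by have -> : ((m.+1 - k)./2 = (m - k)./2)%N by lia.
Qed.

Lemma leq_level m k : (k.+2 <= m.+1)%N -> k.+1 <> m -> (k.+2 <= m)%N.
Proof. lia. Qed.


(* Gap k is the interval (l k, r k); gaps decrease to 0 and are so far apart
   that elements of F move each of them by less than one position.  Block k,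
   [r k.+2, l k], lies between two consecutive gaps of the same parity and
   contains gap k.+1. *)
Definition nested m (l r : nat -> R) :=
  (forall k, (k <= m)%N -> 0 < l k < r k) /\
  (forall k f, (k < m)%N -> f \in F -> act f (r k.+1) < l k).

Definition zigzag m (P : bool -> gT) (l r : nat -> R) :=
  forall k, (k.+2 <= m)%N -> crosses (P (odd k)) (level_sign m k) (r k.+2) (l k).

Lemma nested_r m l r k : nested m l r -> (k < m)%N -> r k.+1 < l k.
Proof. by move=> [_ nr] km; have := nr k _ km F1; rewrite act1. Qed.

Lemma nested_lS m l r k : nested m l r -> (k < m)%N -> l k.+1 < l k.
Proof.
move=> nlr km; apply: lt_trans (nested_r nlr km).
by have /andP[] := nlr.1 k.+1 km.
Qed.

(** Only the element [A] of parity [odd m.+1] changes: a power [h] of it crosses the new block m - 1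
    upwards, and h^-1 e_m h^-1 reverses [h] on all blocks of this parity while staying positive near
    0. *)
Lemma levels_step m P l r : (0 < m < M)%N ->
  nested m l r -> zigzag m P l r ->
  (forall b, germ_ll act (P b) (e m)) ->
  (forall x, 0 < x <= l m -> x < act (P (odd m)) x) ->
  (forall x, 0 < x <= l m.-1 -> x < act (P (odd m.-1)) x) ->
  exists P' l' r', [/\ nested m.+1 l' r', zigzag m.+1 P' l' r',
    (forall b, germ_ll act (P' b) (e m.+1)),
    (forall x, 0 < x <= l' m.+1 -> x < act (P' (odd m.+1)) x) &
    (forall x, 0 < x <= l' m -> x < act (P' (odd m)) x)].
Proof.
move=> /andP[m0 mM] nlr alt Pe up_m up_m1.
have oddm1 : odd m.-1 = odd m.+1 by case: (m) m0 => //= n _; rewrite negbK.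
set A := P (odd m.+1); rewrite oddm1 -/A in up_m1.
have [lm0 lrm] : 0 < l m /\ l m < r m by apply/andP; exact: nlr.1.
have lmm1 : l m < l m.-1.
  by move: (@nested_lS m l r m.-1 nlr); rewrite prednK// leqnn; exact.
(* Elements of [F] send [rn] below [l m], which is the spacing required between gaps m and m + 1. *)
have [rn rn0 Frn] := small_point F lm0.
have rnl : rn < l m by have := Frn _ F1; rewrite act1.
have rnl1 : rn < l m.-1 := lt_trans rnl lmm1.
have [|n crossn] := @crosses_power A rn (l m.-1) (ltW rnl1).
  by move=> x /andP[rx xl]; apply: up_m1; rewrite xl (lt_le_trans rn0 rx).
set h := (A ^+ n.+1)%g in crossn.
have he : germ_ll act h (e m) by apply: germ_llX; exact: Pe.
pose A' := (h^-1 * e m * h^-1)%g.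
have [d d0 upd] := germ_gt1_sandwich he.
have [em Vem] := Fe (ltnW mM).
(* Below [rn], to leave a gap, and below [d], so that [A'] moves up all points of (0, ln]. *)
pose ln := Num.min d rn / 2.
have [ln0 /andP[lnd lnr]] : 0 < ln /\ (ln < d) && (ln < rn).
  rewrite -lt_min /ln; set q := Num.min _ _.
  have : 0 < q by rewrite lt_min d0.
  by split; lra.
pose P' b := if b == odd m.+1 then A' else P b.
pose l' k := if k == m.+1 then ln else l k.
pose r' k := if k == m.+1 then rn else r k.
exists P', l', r'.
have nlr' : nested m.+1 l' r'.
  split=> [k|k f]; rewrite /l' /r'.
    case: eqP => [_ _|/eqP km kSm]; first by rewrite ln0.
    by apply: nlr.1; rewrite -ltnS ltn_neqAle km.
  rewrite ltnS eqSS => km fF; rewrite [k == m.+1]ltn_eqF//.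
  case: eqP => [->|/eqP km']; first exact: Frn.
  by apply: nlr.2 => //; rewrite ltn_neqAle km'.
split=> //.
- move=> k kSm; rewrite /P' /l' /r' eqSS [k == m.+1]ltn_eqF ?(ltnW kSm)//.
  (* The new block m - 1, crossed upwards by [h], gets the sign false. *)
  case: (eqVneq k.+1 m) => [km|/eqP km].
    have -> : k = m.-1 by rewrite -km.
    have -> : level_sign m.+1 m.-1 = ~~ true by rewrite -km /level_sign /= -[k.+2]addn2 addKn.
    rewrite oddm1 eqxx; apply: crosses_flip crossn.
      by rewrite ltW// (lt_trans _ lmm1)//; exact: Frn.
    by rewrite -actV_le ltW// (lt_trans _ lmm1)//; exact: Frn.
  have kSSm := leq_level kSm km.
  have rlk : r k.+2 < l k.+1 by exact: (nested_r nlr).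
  have lk : l k.+1 < l k by apply: (nested_lS nlr); exact: ltnW.
  (* Old blocks of the other parity keep element and sign; on those of the same parity [h] crosses
     like [A], being a positive power of it. *)
  have := alt k kSSm; case: eqP => [oddk|oddk]; last by rewrite level_signS_same.
  rewrite oddk level_signS_flip// => altk.
  apply: crosses_flip (crossesX _ _ altk).
  + by rewrite ltW// (lt_trans _ lk)//; apply: nlr.2.
  + by rewrite -actV_le ltW// (lt_trans _ lk)//; apply: nlr.2.
  + exact/ltW/(lt_trans rlk).
- have emS := e_ll mM.
  have lem : germ_le act (e m) (e m.+1) := germ_ltW (germ_ll_lt emS).
  move=> b; rewrite /P'; case: eqP => _; last exact: germ_ll_le lem.
  have hV := germ_llV (germ_ll_le he lem).
  by do 2?apply: germ_llM.
- move=> x; rewrite /l' /P' !eqxx => /andP[x0 xl].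
  by have := upd x; rewrite act1; apply; rewrite x0 (le_lt_trans xl).
- move=> x; rewrite /l' /P' /=.
  rewrite ltn_eqF//.
  have -> : (odd m == ~~ odd m) = false by case: odd.
  exact: up_m.
Qed.

(** Both elements start as [e 0]; two gaps bound no block yet, so [zigzag] is vacuous. *)
Lemma levels_base : (0 < M)%N -> exists P l r, [/\ nested 1 l r, zigzag 1 P l r,
    (forall b, germ_ll act (P b) (e 1%N)),
    (forall x, 0 < x <= l 1%N -> x < act (P true) x) &
    (forall x, 0 < x <= l 0%N -> x < act (P false) x)].
Proof.
move=> M0; have [d d0 upd] := e0.
have d20 : 0 < d / 2 by lra.
have [r1 r10 Fr1] := small_point F d20.
have r1d : r1 < d / 2 by have := Fr1 _ F1; rewrite act1.
exists (fun=> e 0%N), (fun k => if k is 0%N then d / 2 else r1 / 2).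
exists (fun k => if k is 0%N then d else r1); split.
- split=> [[|[|k]]|[|k] f]//= _; [lra|lra|exact: Fr1].
- by case.
- by move=> _; exact: e_ll.
- by move=> x x1; have := upd x; rewrite act1; apply; lra.
- by move=> x x1; have := upd x; rewrite act1; apply; lra.
Qed.

Lemma levels : (0 < M)%N -> exists P l r, nested M l r /\ zigzag M P l r.
Proof.
move=> M0.
suff: forall m, (0 < m <= M)%N -> exists P l r, [/\ nested m l r, zigzag m P l r,
    (forall b, germ_ll act (P b) (e m)),
    (forall x, 0 < x <= l m -> x < act (P (odd m)) x) &
    (forall x, 0 < x <= l m.-1 -> x < act (P (odd m.-1)) x)].
  by move=> /(_ M); rewrite M0 leqnn => /(_ isT)[P [l [r [? ? _ _ _]]]]; exists P, l, r.
elim=> [//|[_ _|m IH]]; first exact: levels_base.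
move=> mM; have [|P [l [r [nlr alt Pe up1 up2]]]] := IH; first exact: ltnW.
by apply: levels_step nlr alt Pe up1 up2.
Qed.

End Levels.

(** * Words and girth *)

Section Words.
Variables (gT : groupType) (I : eqType).
Implicit Types (g : I -> gT) (i : I) (c : I * bool) (w : seq (I * bool)).

Definition letter_inv c := (c.1, ~~ c.2).

Definition letter_val g c := if c.2 then g c.1 else (g c.1)^-1%g.

Definition word_val g w := foldr (fun c x => letter_val g c * x)%g 1%g w.

Definition reduced w := sorted (fun c c' => c' != letter_inv c) w.

(** Words are over the index type, so two indices with equal values already give a relation of
    length 2. *)
Definition no_short_relation n g := forall w,
  (0 < size w <= n)%N -> reduced w -> word_val g w <> 1%g.

Lemma letter_val_inv g c : letter_val g (letter_inv c) = (letter_val g c)^-1%g.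
Proof. by case: c => i []; rewrite /letter_val/= ?invgK. Qed.

(** The edge labels around a cycle spell a word of value 1 with the length of the cycle, reduced
    because the vertices are distinct. *)
Lemma girth_no_short_relation (R : realType) (G : set gT) n g :
  no_short_relation n g ->
  (n%:R%:E <= graph_girth R (cayley_graph G (range g)))%E.
Proof.
move=> free; apply/ereal_infP => _ [c [c2 /andP[cyc uc]] <-].
rewrite lee_fin ler_nat leqNgt; apply/negP => cn.
case: c c2 cyc uc cn => // x p; set L := (size p).+1.
rewrite /= => L2 /(pathP x); rewrite size_rcons -/L => edge uc Ln.
pose pos j := nth x (x :: rcons p x) j.
have posL : pos L = x by rewrite /pos /= nth_rcons ltnn eqxx.
have pos_c j : (j < L)%N -> pos j = nth x (x :: p) j.
  by case: j => // j jL; rewrite /pos /= nth_rcons (_ : (j < size p)%N).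
have pos_inj j k : (j < L)%N -> (k < L)%N -> pos j = pos k -> j = k.
  by move=> jL kL; rewrite !pos_c// => /eqP; rewrite nth_uniq// => /eqP.
have step j : (j < L)%N -> exists c, pos j.+1 = (pos j * letter_val g c)%g.
  move=> /edge /asboolP[_ _ _ [_ [i _ <-] [e|e]]].
    by exists (i, true).
  by exists (i, false); rewrite /letter_val/= /pos [nth _ (x :: _) j]e mulgK.
have [c0 _] := step 0%N isT.
have /choice[f fP] : forall j, exists c, (j < L)%N -> pos j.+1 = (pos j * letter_val g c)%g.
  by move=> j; case: (ltnP j L) => [/step[c cP]|_]; [exists c|exists c0].
pose w := mkseq f L.
have valw k : forall j, (j + k = L)%N -> pos L = (pos j * word_val g (map f (iota j k)))%g.
  elim: k => [j|k IH j]; first by rewrite addn0 => ->; rewrite mulg1.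
  rewrite -addSnnS => jk; rewrite (IH j.+1 jk) fP/=; last by rewrite -jk ltnS leq_addr.
  by rewrite mulgA.
apply: (free w); first by rewrite size_mkseq (ltnW Ln).
  apply/(sortedP c0) => j; rewrite size_mkseq => jL.
  rewrite !nth_mkseq ?(ltnW jL)//; apply/negP => /eqP cancel.
  have : pos j.+2 = pos j.
    by rewrite fP// cancel letter_val_inv fP ?(ltnW jL)// mulgK.
  (* Position L is the starting vertex again, so the case j + 2 = L forces j = 0 and L = 2, against
     [L2]. *)
  have [jSL|Lj] := ltnP j.+2 L.
    by move=> /(pos_inj _ _ jSL (ltn_trans (ltnSn _) jL)) /eqP; rewrite gtn_eqF// ltnW.
  have -> : j.+2 = L by apply/eqP; rewrite eqn_leq jL.
  rewrite posL -[x]/(pos 0%N) => /(pos_inj _ _ (isT : 0 < L)%N (ltn_trans (ltnSn _) jL)) j0.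
  by move: L2; rewrite -[(2 < L)%N]negbK -leqNgt (leq_trans Lj)// -j0.
apply: (@mulgI _ (pos 0%N)); rewrite mulg1 -(valw L 0%N (add0n L)).
by rewrite posL.
Qed.

End Words.

Lemma no_short_relation_morph (gT hT : groupType) (I : eqType) (f : gT -> hT) n (g : I -> gT) :
  {morph f : x y / (x * y)%g} -> injective f ->
  no_short_relation n g -> no_short_relation n (f \o g).
Proof.
move=> fM fI free w sw rw.
have f1 : f 1%g = 1%g by apply: (@mulgI _ (f 1%g)); rewrite -fM !mulg1.
have fV x : f x^-1%g = (f x)^-1%g.
  by apply: (@mulgI _ (f x)); rewrite -fM !mulgV f1.
have -> : word_val (f \o g) w = f (word_val g w).
  elim: w {sw rw} => [|[i s] w IH] //=; rewrite IH fM.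
  by case: s; rewrite /letter_val//= fV.
rewrite -f1 => /fI; exact: free.
Qed.

(** * Ping-pong *)

Section IntPower.
Variable gT : groupType.
Implicit Types (g : gT) (m n : int).

Definition zpow g n : gT :=
  match n with Posz k => (g ^+ k)%g | Negz k => (g^-1 ^+ k.+1)%g end.

Lemma zpowS g n : zpow g (n + 1) = (g * zpow g n)%g.
Proof.
case: n => k; first by rewrite -PoszD addn1 /zpow expgS.
case: k => [|k]; first by rewrite /zpow expg1 mulgV.
have -> : Negz k.+1 + 1 = Negz k by lia.
by rewrite /zpow [in RHS]expgS mulVKg.
Qed.

Lemma zpowB1 g n : zpow g (n - 1) = (g^-1 * zpow g n)%g.
Proof. by rewrite -[in RHS](subrK 1 n) zpowS mulKg. Qed.

Lemma zpowD g m n : zpow g (m + n) = (zpow g m * zpow g n)%g.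
Proof.
elim/int_ind: m => [|m IH|m IH]; first by rewrite add0r mul1g.
  have -> : m.+1%:Z = m%:Z + 1 by lia.
  by rewrite addrAC !zpowS IH mulgA.
have -> : - m.+1%:Z = - m%:Z - 1 by lia.
by rewrite addrAC !zpowB1 IH mulgA.
Qed.

Lemma zpowN g n : zpow g (- n) = (zpow g n)^-1%g.
Proof. by apply: (@mulgI _ (zpow g n)); rewrite -zpowD subrr mulgV. Qed.

Lemma zpow1 g : zpow g 1 = g. Proof. exact: expg1. Qed.

End IntPower.

Section PingPong.
Variables (R : realType) (gT : groupType) (act : germ_action R gT).
Implicit Types (x y z : R) (p f : gT) (s b : bool) (k : nat) (v w : int).

(* Since p moves the neighbouring blocks in the opposite direction, iterates of
   points of the block are trapped in an adjacent gap. *)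
Lemma crosses_iter p s (d0 d1 d2 d3 d4 d5 : R) n z :
  d0 <= d1 -> d1 < d2 -> d2 <= d3 -> d3 < d4 -> d4 <= d5 ->
  crosses act p (~~ s) d0 d1 -> crosses act p s d2 d3 -> crosses act p (~~ s) d4 d5 ->
  d2 <= z <= d3 ->
  if s then d3 < act (p ^+ n.+1)%g z < d4 else d1 < act (p ^+ n.+1)%g z < d2.
Proof.
case: s => /= d01 d12 d23 d34 d45 c1 c2 c3 /andP[z2 z3]; elim: n => [|n IH].
- rewrite expg1 (lt_le_trans c2) ?act_le//=.
  by rewrite (lt_trans _ c3)// act_lt (le_lt_trans z3)// (lt_le_trans d34).
- rewrite actXS; case/andP: IH => lo hi; apply/andP; split.
    by rewrite (lt_trans c2)// act_lt (le_lt_trans d23).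
  by rewrite (lt_trans _ c3)// act_lt (lt_le_trans hi).
- rewrite expg1 (le_lt_trans _ c2) ?act_le// andbT.
  by rewrite (lt_trans c1)// act_lt (lt_le_trans _ z2)// (le_lt_trans d01).
- rewrite actXS; case/andP: IH => lo hi; apply/andP; split.
    by rewrite (lt_trans c1)// act_lt (le_lt_trans d01).
  by rewrite (lt_trans _ c2)// act_lt (lt_le_trans hi).
Qed.

Variables (M : nat) (F : seq gT) (P : bool -> gT) (l r : nat -> R).
Hypothesis F1 : 1%g \in F.
Hypothesis FV : forall f, f \in F -> f^-1%g \in F.
Hypothesis nlr : nested act F M l r.
Hypothesis alt : zigzag act M P l r.

Definition in_gap k x := l k < x < r k.
Definition in_block k x := r k.+2 <= x <= l k.

(** Blocks k - 2 and k + 2, which exist by the bounds on k, have the sign opposite to that of block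
    k, so [crosses_iter] applies; for negative powers the inverse reverses all three signs. *)
Lemma zpow_block_gap k v z : (2 <= k)%N -> (k.+4 <= M)%N -> v != 0 -> in_block k z ->
  in_gap k (act (zpow (P (odd k)) v) z) \/ in_gap k.+2 (act (zpow (P (odd k)) v) z).
Proof.
case: k => [|[|k]]// _ kM v0 zk; rewrite /in_gap [odd _.+2]/= negbK.
have lr j : (j <= M)%N -> l j < r j by move=> /nlr.1/andP[].
have rl j : (j < M)%N -> r j.+1 < l j by exact: (nested_r F1 nlr).
have rrl j : (j.+2 <= M)%N -> r j.+2 <= l j.
  move=> jM; apply/ltW/(lt_trans (rl j.+1 _))=> //.
  by rewrite (lt_trans (lr _ _))// ?rl// ltnW.
have kM4 : (k.+4 <= M)%N by exact: ltnW (ltnW kM).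
have kM2 : (k.+2 <= M)%N by exact: ltnW (ltnW kM4).
have c0 := alt kM2; have c2 := alt kM4; have c4 := alt (kM : (k.+4.+2 <= M)%N).
rewrite /= !negbK in c2 c4.
have s2 : level_sign M k.+2 = ~~ level_sign M k.
  by rewrite /level_sign negbK; have -> : ((M - k)./2 = (M - k.+2)./2.+1)%N by lia.
have s4 : level_sign M k.+4 = level_sign M k.
  rewrite /level_sign; have -> : ((M - k)./2 = (M - k.+4)./2.+2)%N by lia.
  by rewrite /= negbK.
rewrite s2 in c2; rewrite s4 in c4.
set s := level_sign M k in c0 c2 c4; set p := P (odd k) in c0 c2 c4 *.
have r6 := rrl k.+4 kM; have r4 := rrl k.+2 kM4; have r2 := rrl k kM2.
have g4 := lr k.+4 kM4; have g2 := lr k.+2 kM2.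
have {}zk : r k.+4 <= z <= l k.+2 := zk.
case: v v0 => [[|n]|n] // _.
  have := @crosses_iter p (~~ s) _ _ _ _ _ _ n z r6 g4 r4 g2 r2.
  rewrite negbK => /(_ c4 c2 c0 zk); rewrite /zpow; case: s {c0 c2 c4} => ? /=; by [right|left].
have := @crosses_iter p^-1%g s _ _ _ _ _ _ n z r6 g4 r4 g2 r2.
move: (crossesV c0) (crossesV c2) (crossesV c4); rewrite negbK => {}c0 {}c2 {}c4.
move=> /(_ c4 c2 c0 zk); rewrite /zpow; case: s {c0 c2 c4} => ? /=; by [right|left].
Qed.

Lemma gap_block j f x : (0 < j < M)%N -> f \in F -> in_gap j x -> in_block j.-1 (act f x).
Proof.
case: j => // j /= jM fF /andP[lx xr]; apply/andP; split.
  by rewrite -actV_le ltW// (lt_trans _ lx)//; apply: nlr.2 => //; exact: FV.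
by rewrite ltW// (lt_trans (act_homo act f xr))//; apply: nlr.2 => //; exact: ltnW.
Qed.

(** The power leaves z in gap k or k + 2, which [f] sends into block k - 1 or k + 1, where the other
    element of the pair acts. *)
Lemma block_jump k v f z : (2 <= k)%N -> (k.+4 <= M)%N -> v != 0 -> f \in F ->
  in_block k z -> exists k', [/\ (k <= k'.+1)%N, (k' <= k.+1)%N, odd k' = ~~ odd k &
    in_block k' (act f (act (zpow (P (odd k)) v) z))].
Proof.
move=> k2 kM v0 fF /(zpow_block_gap k2 kM v0)[] /gap_block -/(_ f) H.
  exists k.-1; split; [lia|lia|by case: (k) k2 => //= n; rewrite negbK|].
  by apply: H => //; lia.
exists k.+1; split => //; first lia.
by apply: H => //; lia.
Qed.

Variables (K N : nat) (t : 'I_K -> gT).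
Hypothesis Ft : forall i, t i \in F.

Definition sign_of b : int := if b then 1 else -1.
(* Any two of these exponents, and each of them and 0, differ by more than N,
   so they do not cancel in words of length at most N. *)
Definition shift_exp (i : 'I_K) : int := (N.+1 * i.+1)%N%:Z.

(** The two [P b] are generators too, so that each [t i] can be recovered. *)
Definition ping_gen (i : bool + 'I_K) : gT :=
  match i with
  | inl b => P b
  | inr i => (zpow (P true) (shift_exp i) * t i * zpow (P false) (shift_exp i))%g
  end.

Implicit Types (c : (bool + 'I_K) * bool).

(** The index of the [P] at the right end of the letter, which acts first; inversion exchanges the
    two ends of a generator. *)
Definition source c := match c.1 with inl b => b | inr _ => ~~ c.2 end.

(* The point reached after a reduced word with first letter c is
   P_(odd k)^(a + w) z with z in block k: w counts the letters P_(odd k) at the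
   head of the word, and a is the exponent left by the preceding t i, if any. *)
Definition shape c b (a w : int) :=
  match c.1 with
  | inl b' => [/\ b' = b, 0 < sign_of c.2 * w &
                  a = 0 \/ exists i, a = sign_of b * shift_exp i]
  | inr i => [/\ c.2 = b, w = 0 & a = sign_of b * shift_exp i]
  end.

Definition state c n k x := exists z a w,
  [/\ in_block k z, x = act (zpow (P (odd k)) (a + w)) z,
      (`|w| <= n)%N & shape c (odd k) a w].

Lemma shift_exp_gt i : (N%:Z < shift_exp i).
Proof. rewrite /shift_exp; nia. Qed.

Lemma shift_exp_dist i j : i != j -> (N%:Z < `|shift_exp i - shift_exp j|)%R.
Proof.
move=> ij; have {}ij : nat_of_ord i != nat_of_ord j by [].
rewrite /shift_exp; move: (nat_of_ord i) (nat_of_ord j) ij => a b; nia.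
Qed.

(** A nonzero [a] exceeds N in absolute value while [w] does not; if a = 0, the sign condition makes
    [w] nonzero. *)
Lemma shape_neq0 c b a w n : (n <= N)%N -> (`|w| <= n)%N -> shape c b a w -> a + w != 0.
Proof.
case: c => [[b'|i] s] nN wn; rewrite /shape/=.
  case=> _ sw [->|[i ->]]; first by case: s sw; rewrite /sign_of; lia.
  have := shift_exp_gt i; case: b; rewrite /sign_of; lia.
case=> _ -> ->; have := shift_exp_gt i; case: b; rewrite /sign_of; lia.
Qed.

Lemma letter_val_inr i s : letter_val ping_gen (inr i, s) =
  (zpow (P s) (sign_of s * shift_exp i) * (if s then t i else (t i)^-1)
   * zpow (P (~~ s)) (sign_of s * shift_exp i))%g.
Proof.
have [sT sF] : sign_of true * shift_exp i = shift_exp i /\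
    sign_of false * shift_exp i = - shift_exp i by split; [exact: mul1r|exact: mulN1r].
case: s; rewrite ?sT ?sF // !zpowN /letter_val /ping_gen.
by rewrite [(_, _).2]/= !invgM mulgA.
Qed.

Lemma letter_val_inl b s : letter_val ping_gen (inl b, s) = zpow (P b) (sign_of s).
Proof. by case: s; rewrite /letter_val /sign_of/= ?expg1. Qed.

(** The right-hand power merges with the pending one, the middle factor changes the block, and the
    left-hand power becomes the pending exponent. *)
Lemma state_inr k i s v z : (2 <= k)%N -> (k.+4 <= M)%N -> odd k = ~~ s ->
  sign_of s * shift_exp i + v != 0 -> in_block k z ->
  exists k', [/\ (k <= k'.+1)%N, (k' <= k.+1)%N &
    state (inr i, s) 0 k' (act (letter_val ping_gen (inr i, s)) (act (zpow (P (odd k)) v) z))].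
Proof.
move=> k2 kM ks v0 zk.
have fF : (if s then t i else (t i)^-1)%g \in F by case: (s) => //; exact: FV.
have [k' [kk' k'k oddk' zk']] := block_jump k2 kM v0 fF zk.
rewrite ks negbK in oddk'.
exists k'; split=> //; set x := act _ (act _ z) in zk'.
exists x, (sign_of s * shift_exp i), 0; split=> //.
  by rewrite letter_val_inr addr0 !actM oddk' /x ks zpowD actM.
by rewrite /shape/= oddk'.
Qed.

Lemma state_fresh k c z : (2 <= k)%N -> (k.+4 <= M)%N -> odd k = source c -> in_block k z ->
  exists k', [/\ (k <= k'.+1)%N, (k' <= k.+1)%N & state c 1 k' (act (letter_val ping_gen c) z)].
Proof.
case: c => [[b|i] s] k2 kM; rewrite /source/= => kb zk.
  exists k; split; [exact: ltnW|exact: ltnW|].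
  exists z, 0, (sign_of s); split=> //; rewrite ?letter_val_inl ?add0r ?kb//.
    by case: s.
  by rewrite /shape/=; split; [|case: s|left].
have a0 : sign_of s * shift_exp i + 0 != 0.
  by have := shift_exp_gt i; case: s {kb}; rewrite /sign_of; lia.
have [k' [kk' k'k [x [a [w [xk xE w0 sh]]]]]] := state_inr k2 kM kb a0 zk.
exists k'; split=> //; exists x, a, w; split=> //.
  by rewrite -xE /= act1.
by rewrite (leq_trans w0).
Qed.

Lemma state_step n k c c' x : (n <= N)%N -> (3 <= k)%N -> (k.+4 < M)%N ->
  c != letter_inv c' -> state c' n k x ->
  exists k', [/\ (k <= k'.+2)%N, (k' <= k.+2)%N &
    state c n.+1 k' (act (letter_val ping_gen c) x)].
Proof.
move=> nN k3 kM red [z [a [w [zk -> wn sh]]]].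
have v0 := shape_neq0 nN wn sh.
have k2 : (2 <= k)%N by exact: ltnW.
have kM' : (k.+4 <= M)%N by exact: ltnW.
(* If [c] begins with the other element, the pending nonzero power has already carried the point
   into a block of the right parity; take f = 1. *)
have [src|src] := eqVneq (odd k) (source c); last first.
  have [k1 [kk1 k1k oddk1]] := block_jump k2 kM' v0 F1 zk.
  rewrite act1 => zk1.
  have [|||k' [k1k' k'k1 [z' [a' [w' [zk' xE w1 sh']]]]]] := @state_fresh k1 c _ _ _ _ zk1.
  - lia.
  - lia.
  - by rewrite oddk1; case: (odd k) (source c) src => [] [].
  exists k'; split; [lia|lia|exists z', a', w'; split=> //].
  by rewrite (leq_trans w1).
case: c src red => [[b|i] s] /= src red; rewrite /source/= in src.
  exists k; split; [lia|lia|exists z, a, (w + sign_of s)].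
  split=> //; first by rewrite letter_val_inl -src -actM -zpowD; congr (act (zpow _ _) _); lia.
    by case: s {red}; rewrite /sign_of; lia.
  move: sh red; case: c' => [[b'|i'] s'] /=; rewrite /shape/= /letter_inv/=; last first.
    case=> _ -> ->; split=> //; first by case: s.
    by right; exists i'.
  case=> bk ws; rewrite bk src xpair_eqE eqxx/= => aP ss'.
  split=> //.
  by case: s s' ws ss' => [] []; rewrite /sign_of; lia.
(* A shift, or a difference of two distinct shifts, exceeds N. Equal indices leave the nonzero [w]
   or, if [c'] is an [inr] letter, contradict reducedness. *)
have a0 : sign_of s * shift_exp i + (a + w) != 0.
  have bi := shift_exp_gt i.
  move: sh red; case: c' => [[b'|i'] s'] /=; rewrite /shape/= /letter_inv/=.
    case=> _ sw [->|[i' ->]] _; first by case: s {src}; rewrite /sign_of; lia.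
    rewrite src; have [ii'|/shift_exp_dist] := eqVneq i i'.
      by subst i'; case: s s' sw {src} => [] []; rewrite /sign_of/=; lia.
    by case: s {src}; rewrite /sign_of/=; lia.
  case=> -> -> ->; rewrite src negbK xpair_eqE eqxx andbT => ii'.
  have /shift_exp_dist : i != i' by apply: contraNneq ii' => ->.
  by case: s {src}; rewrite /sign_of/=; lia.
have [k' [kk' k'k [z' [a' [w' [zk' xE w1 sh']]]]]] := state_inr k2 kM' src a0 zk.
exists k'; split; [lia|lia|exists z', a', w'; split=> //].
by rewrite (leq_trans w1).
Qed.

(** The point [l k0.+1] lies in blocks k0 and k0 + 1, one of which suits the first letter applied.
    Each further letter shifts the index by at most 2. *)
Lemma state_word k0 (w : seq ((bool + 'I_K) * bool)) :
  (2 * N + 4 <= k0)%N -> (k0 + 2 * N + 6 < M)%N ->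
  (0 < size w <= N)%N -> reduced w ->
  exists k, [/\ (k0 <= k + 2 * size w)%N, (k <= k0 + 1 + 2 * size w)%N &
    state (head (inl true, true) w) (size w) k (act (word_val ping_gen w) (l k0.+1))].
Proof.
move=> k0N k0M; elim: w => // c w IH /= wN red.
have rl j : (j < M)%N -> r j.+1 < l j by exact: (nested_r F1 nlr).
have ll j : (j < M)%N -> l j.+1 < l j by exact: (nested_lS F1 nlr).
case: w IH red wN => [|c' w] IH red wN.
  have [k [k0k kk0 ksrc kblock]] : exists k, [/\ (k0 <= k)%N, (k <= k0.+1)%N,
      odd k = source c & in_block k (l k0.+1)].
    have [src|src] := eqVneq (odd k0) (source c).
      exists k0; split=> //; rewrite /in_block !ltW//; [apply: ll|apply: rl]; lia.
    exists k0.+1; split=> //; first by move: src => /=; case: odd (source c) => [] [].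
    rewrite /in_block lexx andbT ltW// (lt_trans (rl _ _)) ?ll//; lia.
  have [||k' [kk' k'k st]] := @state_fresh k c _ _ _ ksrc kblock; [lia|lia|].
  by exists k'; split; [lia|lia|rewrite mulg1].
have [||k [k0k kk0 st]] := IH; [by move: wN => /=; lia|by case/andP: red|].
rewrite /= in k0k kk0 st wN.
have [||||k' [kk' k'k st']] := @state_step _ k c c' _ _ _ _ _ st.
- lia.
- lia.
- lia.
- case/andP: red => red _; apply: contraNneq red => ->.
  by rewrite /letter_inv /= negbK; case: (c').
exists k'; split; last by rewrite /= actM.
- by rewrite /=; lia.
- by rewrite /=; lia.
Qed.

(** A trivial word would fix the starting point; but its image moves into an open gap if read as a
    nonzero power applied to a point of a block, and an end [l] of a gap lies in no gap. *)
Lemma ping_pong : (4 * N + 10 < M)%N -> no_short_relation N ping_gen.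
Proof.
move=> NM; suff free (w : seq ((bool + 'I_K) * bool)) : (0 < size w <= N)%N ->
    reduced w -> word_val ping_gen w = 1%g -> False by move=> w; exact: free.
move=> wN red w1.
have [||k [k0k kk0 [z [a [v [zk xE vn sh]]]]]] := @state_word (2 * N + 4) w _ _ wN red.
- by [].
- lia.
have v0 := shape_neq0 (_ : size w <= N)%N vn sh.
have /andP[k4 kN] : (4 <= k <= 4 * N + 5)%N by move: wN; lia.
rewrite w1 act1 in xE; clear k0k kk0; set k0 := (2 * N + 4)%N in xE.
have k0M : (k0.+1 < M)%N by rewrite /k0; lia.
have lr j : (j <= M)%N -> l j < r j by move=> /nlr.1/andP[].
have rl j : (j < M)%N -> r j.+1 < l j by exact: (nested_r F1 nlr).
have lle i j : (i <= j <= M)%N -> l j <= l i.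
  case/andP=> /subnK <-; elim: (j - i)%N => // d IH dM.
  by rewrite addSn (le_trans _ (IH _)) ?ltW//; [apply: (nested_lS F1 nlr); lia|lia].
have notgap j : (j <= M)%N -> ~ in_gap j (l k0.+1).
  move=> jM /andP[]; have [jk|kj] := leqP j k0.+1.
    by rewrite ltNge lle//; lia.
  move=> _; rewrite ltNge ltW//; case: j jM kj => // j jM kj.
  by rewrite (lt_le_trans (rl _ _))// lle//; lia.
have [|||gap|gap] := zpow_block_gap _ _ (v0 _) zk.
- exact: ltnW (ltnW k4).
- by lia.
- by case/andP: wN.
- by rewrite -xE in gap; move: gap; apply: notgap; lia.
- by rewrite -xE in gap; move: gap; apply: notgap; lia.
Qed.

End PingPong.

(** * Closure properties of subgroups *)

Lemma subgroupM (gT : groupType) (H : set gT) x y :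
  subgroup H -> H x -> H y -> H (x * y)%g.
Proof.
by move=> /group_closedM HM Hx Hy; apply/set_mem/HM; apply/mem_set.
Qed.

Lemma subgroupV (gT : groupType) (H : set gT) x : subgroup H -> H x -> H x^-1%g.
Proof. by move=> /group_closedV HV Hx; apply/set_mem/HV; apply/mem_set. Qed.

Lemma subgroup1 (gT : groupType) (H : set gT) : subgroup H -> H 1%g.
Proof. by move=> [/set_mem]. Qed.

Lemma subgroupX (gT : groupType) (H : set gT) x n :
  subgroup H -> H x -> H (x ^+ n)%g.
Proof.
move=> H_sub Hx; elim: n => [|n IH]; first exact: subgroup1.
by rewrite expgS; exact: subgroupM.
Qed.

Lemma subgroup_zpow (gT : groupType) (H : set gT) x n :
  subgroup H -> H x -> H (zpow x n).
Proof.
by move=> H_sub Hx; case: n => n; apply: subgroupX => //; exact: subgroupV.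
Qed.

(** * Generators without short relations when no germ is minimal *)

Section NoMinimalGerm.
Variables (R : realType) (gT : groupType) (act : germ_action R gT).
Implicit Types (g a : gT).

(** Passing to an inverse makes the small element positive; the chain descends from [g] and is
    numbered backwards. *)
Lemma germ_chain M g : (forall g, germ_lt act 1%g g -> exists2 a, a <> 1%g & germ_ll act a g) ->
  germ_lt act 1%g g -> exists e : nat -> gT, germ_lt act 1%g (e 0%N) /\
    forall k, (k < M)%N -> germ_ll act (e k) (e k.+1).
Proof.
move=> nomin g1.
have /choice[f fP] : forall g, exists a, germ_lt act 1%g g ->
    germ_lt act 1%g a /\ germ_ll act a g.
  move=> h; have [h1|] := pselect (germ_lt act 1%g h); last by exists 1%g.
  have [a a1 ah] := nomin h h1.
  have [//|lt1a|lta1] := germ_total act a 1%g.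
    exists a^-1%g => _; split; last exact: germ_llV.
    by have := germ_ltV lt1a; rewrite invg1.
  by exists a.
have iter1 k : germ_lt act 1%g (iter k f g) by elim: k => //= k /fP[].
exists (fun k => iter (M - k) f g); split=> // k kM.
by rewrite -(subnSK kM); exact: (fP _ (iter1 _)).2.
Qed.

Lemma no_short_relation_exists n K (t : 'I_K -> gT) :
  (forall g, germ_lt act 1%g g -> exists2 a, a <> 1%g & germ_ll act a g) ->
  (exists g, germ_lt act 1%g g) ->
  exists s : (bool + 'I_K)%type -> gT, no_short_relation n s /\
    forall H : set gT, subgroup H -> range s `<=` H -> range t `<=` H.
Proof.
(* The least number of levels that [ping_pong] accepts. *)
move=> nomin [g g1]; pose M := (4 * n + 11)%N.
have [e [e0 e_ll]] := germ_chain M nomin g1.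
pose F0 := 1%g :: codom t ++ [seq e k | k <- iota 0 M.+1].
pose F := F0 ++ [seq f^-1%g | f <- F0].
have FV f : f \in F -> f^-1%g \in F.
  rewrite !mem_cat => /orP[fF0|/mapP[f' f'F0 ->]]; last by rewrite invgK f'F0.
  by rewrite map_f ?orbT.
have F1 : 1%g \in F by rewrite /F /= in_cons eqxx.
have Fe k : (k <= M)%N -> e k \in F /\ (e k)^-1%g \in F.
  move=> kM; have ekF : e k \in F.
    by rewrite mem_cat in_cons mem_cat map_f ?orbT// mem_iota.
  by split; last exact: FV.
have Ft i : t i \in F by rewrite mem_cat in_cons mem_cat codom_f ?orbT.
have [|P [l [r [nlr alt]]]] := levels F1 Fe e0 e_ll; first by rewrite /M addnS.
exists (ping_gen P n t); split.
  by apply: (ping_pong F1 FV nlr alt Ft); rewrite ltn_add2l.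
move=> H H_sub sH _ [i _ <-].
have HP b : H (P b) by apply: sH; exists (inl b).
have -> : t i = (zpow (P true) (- shift_exp n i) * ping_gen P n t (inr i)
    * zpow (P false) (- shift_exp n i))%g.
  by rewrite /ping_gen !zpowN !mulgA mulVg mul1g mulgK.
do 2?apply: subgroupM => //; try exact: subgroup_zpow.
by apply: sH; exists (inr i).
Qed.

End NoMinimalGerm.

(** * Hoelder's theorem *)

Section Hoelder.
Variables (R : realType) (gT : groupType) (act : germ_action R gT).
Variables (D : set gT) (u : gT).
Hypothesis D_sub : subgroup D.
Hypothesis Du : D u.
Hypothesis u1 : germ_lt act 1%g u.
Hypothesis D_le : forall a, D a -> exists n, germ_le act a (u ^+ n)%g.
Hypothesis D_ge : forall a, D a -> germ_lt act 1%g a -> exists n, germ_le act u (a ^+ n)%g.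

Local Notation "a <=g b" := (germ_le act a b) (at level 70).
Local Notation "a <g b" := (germ_lt act a b) (at level 70).
Implicit Types (a b v : gT) (m : int) (n k : nat).

Let DM a b : D a -> D b -> D (a * b)%g := @subgroupM _ D a b D_sub.
Let DV a : D a -> D a^-1%g := @subgroupV _ D a D_sub.
Let DX a n : D a -> D (a ^+ n)%g := @subgroupX _ D a n D_sub.
Let DZ a m : D a -> D (zpow a m) := @subgroup_zpow _ D a m D_sub.

Lemma germ_lt_irr a : ~ (a <g a).
Proof. exact/germ_le_ltF/germ_lexx. Qed.

Lemma germ_X_gt1 v n : 1%g <g v -> 1%g <g (v ^+ n.+1)%g.
Proof.
move=> v1; rewrite expgS; apply: (germ_lt_le_trans v1).
have := germ_leM (germ_lexx act v) (germ_ge1_X n (germ_ltW v1)).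
by rewrite mulg1.
Qed.

Lemma zpow_lt v m m' : 1%g <g v -> m < m' -> zpow v m <g zpow v m'.
Proof.
move=> v1 mm'; have -> : m' = m + (`|m' - m|%N.-1.+1)%:Z by lia.
rewrite zpowD -{1}[zpow v m]mulg1; apply: germ_ltMl.
exact: germ_X_gt1.
Qed.

Lemma zpow_le_inv v m m' : 1%g <g v -> zpow v m <=g zpow v m' -> m <= m'.
Proof.
move=> v1 le; rewrite leNgt; apply/negP => /(zpow_lt v1).
exact: germ_le_ltF.
Qed.

(** Once a v^k is at least 1, the least n with a v^k < v^n gives the floor n - 1 - k. *)
Lemma germ_floor v a : 1%g <g v -> (forall b, D b -> exists n, b <=g (v ^+ n)%g) -> D v ->
  D a -> exists m, zpow v m <=g a /\ a <g zpow v (m + 1).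
Proof.
move=> v1 bnd Dv Da; have [k ak] := bnd _ (DV Da).
have [j aj] := bnd _ (DM Da (DX k Dv)).
have a1 : 1%g <=g (a * v ^+ k)%g.
  by have := germ_leM (germ_lexx act a) ak; rewrite mulgV.
have ex_n : exists n, `[< (a * v ^+ k)%g <g (v ^+ n)%g >].
  exists j.+1; apply/asboolP; apply: germ_le_lt_trans aj _.
  by apply: (@zpow_lt v j j.+1 v1); lia.
case: (ex_minnP ex_n) => [[|n] /asboolP ltn minn].
  by case: (germ_le_ltF a1 ltn).
have len : (v ^+ n)%g <=g (a * v ^+ k)%g.
  have [//|/asboolP/minn] := germ_leVgt act (v ^+ n)%g (a * v ^+ k)%g.
  by rewrite ltnn.
exists (n%:Z - k%:Z); split.
  have := germ_leM len (germ_lexx act (v ^- k)%g); rewrite mulgK.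
  by rewrite zpowD zpowN.
have := germ_ltMr (v ^- k)%g ltn; rewrite mulgK.
by have -> : n%:Z - k%:Z + 1 = n.+1%:Z - k%:Z by [lia]; rewrite zpowD zpowN.
Qed.

Lemma D_bounded v : D v -> 1%g <g v -> forall b, D b -> exists n, b <=g (v ^+ n)%g.
Proof.
move=> Dv v1 b /D_le[n bn]; have [k uk] := D_ge Dv v1.
by exists (k * n)%N; apply: germ_le_trans bn _; rewrite expgnA; exact: germ_leX.
Qed.

Lemma zpow_comm v m m' : (zpow v m * zpow v m' = zpow v m' * zpow v m)%g.
Proof. by rewrite -!zpowD addrC. Qed.

(* Suppose c = (ab)(ba)^-1 > 1.  If some v > 1 in D has v^2 <= c, the floors of a
   and b in powers of v give c < v^2, a contradiction; otherwise c is the least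
   element above 1 and D is cyclic. *)
Lemma hoelder_comm a b : D a -> D b -> (a * b = b * a)%g.
Proof.
suff key a' b' : D a' -> D b' -> (b' * a' <g a' * b')%g -> False.
  move=> Da Db; have [//|ab|ba] := germ_total act (a * b)%g (b * a)%g.
    by case: (key b a Db Da ab).
  by case: (key a b Da Db ba).
move=> {a b} Da Db lt; move: a' b' Da Db lt => a b Da Db lt.
pose c := ((a * b) * (b * a)^-1)%g.
have Dc : D c by apply: DM; [exact: DM|apply: DV; exact: DM].
have c1 : 1%g <g c by have := germ_ltMr (b * a)^-1%g lt; rewrite mulgV.
have nosq v : D v -> 1%g <g v -> (v * v)%g <=g c -> False.
  move=> Dv v1 vc.
  have [m [ma am]] := germ_floor v1 (D_bounded Dv v1) Dv Da.
  have [k [kb bk]] := germ_floor v1 (D_bounded Dv v1) Dv Db.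
  have ba := germ_leV (germ_leM kb ma).
  have ab : (a * b)%g <g (zpow v (m + 1) * zpow v (k + 1))%g.
    apply: germ_lt_le_trans (germ_ltMr b am) _.
    exact: germ_leM (germ_lexx _ _) (germ_ltW bk).
  have cv : c <g (v * v)%g.
    apply: germ_lt_le_trans (germ_ltMr _ ab) _.
    apply: germ_le_trans (germ_leM (germ_lexx _ _) ba) _.
    rewrite -!zpowD -zpowN -zpowD.
    have -> : m + 1 + (k + 1) - (k + m) = 2 by lia.
    by rewrite -expg2; exact: germ_lexx.
  exact: germ_le_ltF vc cv.
have least v : D v -> 1%g <g v -> c <=g v.
  move=> Dv v1; have [//|vc] := germ_leVgt act c v; exfalso.
  pose w := (v^-1 * c)%g.
  have Dw : D w by apply: DM => //; exact: DV.
  have w1 : 1%g <g w by have := germ_ltMl v^-1%g vc; rewrite mulVg.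
  have vw : (v * w = c)%g by rewrite mulVKg.
  have [lvw|lwv] := germ_leVgt act v w.
    by apply: (nosq v) => //; rewrite -vw; exact: germ_leM (germ_lexx _ _) lvw.
  apply: (nosq w) => //; rewrite -vw.
  exact: germ_leM (germ_ltW lwv) (germ_lexx _ _).
have cyc x : D x -> exists m, x = zpow c m.
  move=> Dx; have [m [mx xm]] := germ_floor c1 (D_bounded Dc c1) Dc Dx.
  exists m; apply: contrapT => neq.
  have Dy : D (zpow c (- m) * x)%g by apply: DM => //; exact: DZ.
  have y1 : 1%g <g (zpow c (- m) * x)%g.
    have [xE|xlt|lt1] := germ_total act x (zpow c m); first by case: neq.
      by case: (germ_le_ltF mx xlt).
    by have := germ_ltMl (zpow c (- m)) lt1; rewrite zpowN mulVg.
  have := germ_ltMl (zpow c (- m)) xm; rewrite -zpowD addKr.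
  by rewrite zpow1 => /(germ_le_ltF (least _ Dy y1)).
have [m am] := cyc _ Da; have [k bk] := cyc _ Db.
by move: lt; rewrite am bk zpow_comm => /germ_lt_irr.
Qed.

(** The lower rational cut of the logarithm of [a] to base [u]. *)
Definition cuts a : set R :=
  [set q | exists m n, q = m%:~R / n.+1%:R /\ zpow u m <=g (a ^+ n.+1)%g].

Definition hoelder_map a : R := sup (cuts a).

Lemma zpowX v m n : zpow v (m * n%:Z) = (zpow v m ^+ n)%g.
Proof.
elim: n => [|n IH]; first by rewrite mulr0.
by rewrite expgS -IH -zpowD; congr zpow; lia.
Qed.

Lemma cuts_neq0 a : D a -> cuts a !=set0.
Proof.
move=> Da; have [m [ma _]] := germ_floor u1 D_le Du Da.
by exists (m%:~R / 1), m, 0%N; rewrite expg1.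
Qed.

(** From u^m <= a^(n+1) and a^q <= u^p follows u^(mq) <= u^(p(n+1)). *)
Lemma cuts_le a (p q : int) : 0 < q -> germ_le act (zpow a q) (zpow u p) ->
  ubound (cuts a) (p%:~R / q%:~R).
Proof.
move=> q0 aq _ [m [n [-> mn]]].
have qR : 0 < q%:~R :> R by rewrite ltr0z.
rewrite ler_pdivrMr ?ltr0n// mulrAC ler_pdivlMr//.
rewrite -[n.+1%:R]/(n.+1%:Z%:~R) -!intrM ler_int.
apply: (zpow_le_inv u1); case: q q0 aq {qR} => // q q0 aq.
rewrite zpowX; apply: germ_le_trans (germ_leX q mn) _.
rewrite zpowX -expgnA mulnC expgnA.
exact: germ_leX.
Qed.

Lemma cuts_ub a : D a -> has_ubound (cuts a).
Proof.
move=> Da; have [n an] := D_le Da; exists (n%:Z%:~R / 1%:~R).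
by apply: cuts_le => //; rewrite /zpow expg1.
Qed.

Lemma hoelder_ge a m n : D a -> zpow u m <=g (a ^+ n.+1)%g ->
  m%:~R / n.+1%:R <= hoelder_map a.
Proof. by move=> Da le; apply: ub_le_sup; [exact: cuts_ub|exists m, n]. Qed.

(** Cuts of [a] and [b] add over a common denominator, since powers of ab split by commutativity. *)
Lemma hoelder_superadd a b : D a -> D b ->
  hoelder_map a + hoelder_map b <= hoelder_map (a * b)%g.
Proof.
move=> Da Db; rewrite -lerBrDr; apply: ge_sup; first exact: cuts_neq0.
move=> _ [m [n [-> mn]]]; rewrite lerBrDl -lerBrDr.
apply: ge_sup; first exact: cuts_neq0.
move=> _ [m' [n' [-> mn']]]; rewrite lerBrDr addrC.
apply: (@le_trans _ _ ((m * n'.+1%:Z + m' * n.+1%:Z)%:~R / (n.+1 * n'.+1).-1.+1%:R)).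
  rewrite prednK ?muln_gt0// natrM intrD !intrM.
  have n0 : n.+1%:R != 0 :> R by rewrite pnatr_eq0.
  have n'0 : n'.+1%:R != 0 :> R by rewrite pnatr_eq0.
  by rewrite addf_div// mulrC [X in _ <= X / _]addrC.
apply: hoelder_ge; first exact: DM.
rewrite prednK ?muln_gt0// zpowD !zpowX.
rewrite (expgMn _ (hoelder_comm Da Db)).
apply: germ_leM; first by rewrite expgnA; exact: germ_leX.
by rewrite mulnC expgnA; exact: germ_leX.
Qed.

(** Enclosing a^(n+1) between u^m and u^(m+1) bounds both values from below, with a total error of
    1/(n+1). *)
Lemma hoelder_opp a : D a -> - hoelder_map a <= hoelder_map a^-1%g.
Proof.
move=> Da; apply/ler_addgt0Pr => e e0.
have [n ne] : exists n, n.+1%:R^-1 < e.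
  by have [n _ /(_ n (leqnn n))] := near_infty_natSinv_lt (PosNum e0); exists n.
have [m [ma am]] := germ_floor u1 D_le Du (DX n.+1 Da).
have le1 := hoelder_ge Da ma.
have le2 : (- (m + 1))%:~R / n.+1%:R <= hoelder_map a^-1%g.
  apply: hoelder_ge; first exact: DV.
  by rewrite zpowN expVgn; exact/germ_leV/germ_ltW.
move: le1 le2; rewrite intrN intrD mulNr mulrDl mul1r.
set x := _ / _ => le1 le2; set y := _^-1 in ne le2; lra.
Qed.

(** Superadditivity for ab and b^-1, with [hoelder_opp], gives the reverse inequality. *)
Lemma hoelder_mapM a b : D a -> D b ->
  hoelder_map (a * b)%g = hoelder_map a + hoelder_map b.
Proof.
move=> Da Db; have Dab := DM Da Db.
have := hoelder_superadd Da Db; have := hoelder_superadd Dab (DV Db).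
rewrite mulgK; have := hoelder_opp Db.
by move=> *; apply/eqP; rewrite eq_le; apply/andP; split; lra.
Qed.

Lemma hoelder_gt0 a : D a -> 1%g <g a -> 0 < hoelder_map a.
Proof.
move=> Da a1; have [[|n] un] := D_ge Da a1.
  by case: (germ_le_ltF un u1).
apply: (@lt_le_trans _ _ (1%:~R / n.+1%:R)); first by rewrite mul1r invr_gt0 ltr0n.
by apply: hoelder_ge => //; rewrite zpow1.
Qed.

Lemma additiveX (chi : gT -> R) a n :
  (forall a b, D a -> D b -> chi (a * b)%g = chi a + chi b) -> D a ->
  chi (a ^+ n)%g = chi a *+ n.
Proof.
move=> chiM Da; elim: n => [|n IH].
  have := chiM 1%g 1%g (subgroup1 D_sub) (subgroup1 D_sub).
  by rewrite mulg1 expg0 mulr0n => ?; lra.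
by rewrite expgS chiM ?IH ?mulrS//; exact: DX.
Qed.

Lemma additiveV (chi : gT -> R) a :
  (forall a b, D a -> D b -> chi (a * b)%g = chi a + chi b) -> D a ->
  chi a^-1%g = - chi a.
Proof.
move=> chiM Da; have := additiveX 0 chiM Da; have := chiM a a^-1%g Da (DV Da).
by rewrite mulgV expg0 mulr0n; lra.
Qed.

Lemma additiveZ (chi : gT -> R) a m :
  (forall a b, D a -> D b -> chi (a * b)%g = chi a + chi b) -> D a ->
  chi (zpow a m) = chi a * m%:~R.
Proof.
move=> chiM Da; case: m => n; rewrite /zpow additiveX//; last exact: DV.
  by rewrite -mulr_natr.
by rewrite additiveV// NegzE -mulr_natr mulNr intrN mulrN.
Qed.

(** Evaluating the monotone [chi] on cuts gives one inequality; applied to a^-1 it gives the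
    other. *)
Lemma hoelder_map_unique (chi : gT -> R) :
  (forall a b, D a -> D b -> chi (a * b)%g = chi a + chi b) ->
  (forall a, D a -> 1%g <g a -> 0 < chi a) ->
  forall a, D a -> chi a = chi u * hoelder_map a.
Proof.
move=> chiM chi0; have chiu := chi0 u Du u1.
have chi_le b b' : D b -> D b' -> b <=g b' -> chi b <= chi b'.
  move=> Db Db' bb'; have [-> //|lt|lt] := germ_total act b b'; last first.
    by case: (germ_le_ltF bb' lt).
  have := chi0 (b^-1 * b')%g (DM (DV Db) Db').
  rewrite chiM ?additiveV//; last exact: DV.
  have := germ_ltMl b^-1%g lt; rewrite mulVg => lt1 /(_ lt1); lra.
have le_chi a : D a -> chi u * hoelder_map a <= chi a.
  move=> Da; rewrite mulrC -ler_pdivlMr//; apply: ge_sup; first exact: cuts_neq0.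
  move=> _ [m [n [-> /chi_le]]]; rewrite additiveZ// additiveX// => le.
  rewrite ler_pdivlMr// mulrAC ler_pdivrMr ?ltr0n// mulrC mulr_natr.
  by apply: le; [exact: DZ|exact: DX].
move=> a Da; apply/eqP; rewrite eq_le le_chi// andbT.
have := le_chi _ (DV Da).
by rewrite (additiveV hoelder_mapM)// additiveV// mulrN lerN2.
Qed.

(** Uniqueness, applied to the map itself, shows its positive value at [u] to equal its own
    square. *)
Lemma hoelder_map_u : hoelder_map u = 1.
Proof.
have := hoelder_map_unique hoelder_mapM hoelder_gt0 Du.
have := hoelder_gt0 Du u1; nra.
Qed.

Lemma hoelder_map_lt a b : D a -> D b -> a <g b -> hoelder_map a < hoelder_map b.
Proof.
move=> Da Db /(germ_ltMl a^-1%g); rewrite mulVg => lt1.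
have := hoelder_gt0 (DM (DV Da) Db) lt1.
by rewrite hoelder_mapM ?(additiveV hoelder_mapM)//; [lra|exact: DV].
Qed.

Lemma hoelder_map_inj a b : D a -> D b -> hoelder_map a = hoelder_map b -> a = b.
Proof.
move=> Da Db ab; have [//|/(hoelder_map_lt Da Db)|/(hoelder_map_lt Db Da)] := germ_total act a b.
  by rewrite ab ltxx.
by rewrite ab ltxx.
Qed.

End Hoelder.

(** * Affine representations *)

(** A faithful homomorphism sending c to x -> lam c * x + tau c. *)
Definition affine_rep (R : realType) (gT : groupType) (lam tau : gT -> R) :=
  [/\ forall c, 0 < lam c, forall c d, lam (c * d)%g = lam c * lam d,
      forall c d, tau (c * d)%g = lam c * tau d + tau c &
      forall c, lam c = 1 -> tau c = 0 -> c = 1%g].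

(** * The convex subgroup of a minimal germ and its dilations *)

Section MinimalGerm.
Variables (R : realType) (gT : groupType) (act : germ_action R gT).
Variable u : gT.
Hypothesis u1 : germ_lt act 1%g u.
Hypothesis u_min : forall a, germ_ll act a u -> a = 1%g.
Implicit Types (a b c d v : gT) (x y z : R).

Local Notation "a <=g b" := (germ_le act a b) (at level 70).
Local Notation "a <g b" := (germ_lt act a b) (at level 70).

Definition least_convex : set gT :=
  [set a | exists n, a <=g (u ^+ n)%g /\ a^-1%g <=g (u ^+ n)%g].
Local Notation D := least_convex.

Lemma least_convex_subgroup : subgroup D.
Proof.
split.
  by apply/mem_set; exists 0%N; rewrite invg1 expg0; split; exact: germ_lexx.
move=> a b /set_mem[n [an aVn]] /set_mem[m [bm bVm]]; apply/mem_set.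
exists (n + m)%N; split; rewrite ?invgF expgnDr; first exact: germ_leM.
by rewrite -expgnDr addnC expgnDr; exact: germ_leM.
Qed.

Lemma least_convex_u : D u.
Proof.
exists 1%N; rewrite expg1; split; first exact: germ_lexx.
by apply: germ_le_trans (germ_leV1 (germ_ltW u1)) (germ_ltW u1).
Qed.

Lemma least_convex_le a : D a -> exists n, a <=g (u ^+ n)%g.
Proof. by move=> [n []]; exists n. Qed.

(** If all powers of [a] stay below [u], then a << u, so a = 1 by minimality. *)
Lemma least_convex_ge a : 1%g <g a -> exists n, u <=g (a ^+ n)%g.
Proof.
move=> a1; apply: contrapT => small; apply: (@germ_lt_irr _ _ act 1%g).
rewrite -{2}(u_min (a := a)) => //; apply: germ_ll_dom (germ_ltW a1) _ => n.
by have [uan|//] := germ_leVgt act u (a ^+ n)%g; case: small; exists n.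
Qed.

(** If c u c^-1 exceeded all powers of [u], then c^-1 u c << u, hence u = 1. *)
Lemma least_convex_conj c a : D a -> D (c * a * c^-1)%g.
Proof.
have [m um] : exists m, (c * u * c^-1)%g <=g (u ^+ m)%g.
  apply: contrapT => big; apply: (@germ_lt_irr _ _ act 1%g).
  pose w := (c^-1 * u * c^-1^-1)%g.
  have uw : u = (c * w * c^-1)%g by rewrite /w !mulgA invgK mulgV mul1g mulgK.
  rewrite {2}(_ : 1%g = u) //; rewrite uw (u_min (a := w)) ?mulg1 ?mulgV//.
  apply: germ_ll_dom => [|n].
    by have := germ_conj_le c^-1%g (germ_ltW u1); rewrite mulg1 mulgV.
  have [le|] := germ_leVgt act (c * u * c^-1)%g (u ^+ n)%g.
    by case: big; exists n.
  by move=> /(germ_conj_lt c^-1%g); rewrite conj_exp -/w !mulgA invgK mulVg mul1g mulgVK.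
have conj_le b n : b <=g (u ^+ n)%g -> (c * b * c^-1)%g <=g (u ^+ (m * n))%g.
  move=> /(germ_conj_le c) le; apply: germ_le_trans le _.
  by rewrite conj_exp expgnA; exact: germ_leX.
move=> [n [an aVn]]; exists (m * n)%N; split; first exact: conj_le.
have -> : (c * a * c^-1)^-1%g = (c * a^-1 * c^-1)%g by rewrite !invgM invgK mulgA.
exact: conj_le.
Qed.

Local Notation phi := (hoelder_map act u).

Let DM a b : D a -> D b -> D (a * b)%g := @subgroupM _ D a b least_convex_subgroup.
Let DV a : D a -> D a^-1%g := @subgroupV _ D a least_convex_subgroup.
Let DX a n : D a -> D (a ^+ n)%g := @subgroupX _ D a n least_convex_subgroup.
Let DZ a m : D a -> D (zpow a m) := @subgroup_zpow _ D a m least_convex_subgroup.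
Let D_ge a (_ : D a) := @least_convex_ge a.

Lemma phiM a b : D a -> D b -> phi (a * b)%g = phi a + phi b.
Proof. exact: (hoelder_mapM least_convex_subgroup least_convex_u u1 least_convex_le D_ge). Qed.

Lemma phiV a : D a -> phi a^-1%g = - phi a.
Proof. exact: (additiveV least_convex_subgroup phiM). Qed.

Lemma phi_gt0 a : D a -> 1%g <g a -> 0 < phi a.
Proof. exact: (hoelder_gt0 u1 least_convex_le D_ge). Qed.

Lemma phi_lt a b : D a -> D b -> a <g b -> phi a < phi b.
Proof. exact: (hoelder_map_lt least_convex_subgroup least_convex_u u1 least_convex_le D_ge). Qed.

Lemma phi_inj a b : D a -> D b -> phi a = phi b -> a = b.
Proof. exact: (hoelder_map_inj least_convex_subgroup least_convex_u u1 least_convex_le D_ge). Qed.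

Lemma phi_u : phi u = 1.
Proof. exact: (hoelder_map_u least_convex_subgroup least_convex_u u1 least_convex_le D_ge). Qed.

Lemma least_convex_comm a b : D a -> D b -> (a * b = b * a)%g.
Proof.
move=> Da Db; apply: (phi_inj (DM Da Db) (DM Db Da)).
by rewrite (phiM Da Db) (phiM Db Da) addrC.
Qed.

Definition dilation c : R := phi (c * u * c^-1)%g.

Lemma conj_mul c a b : (c * (a * b) * c^-1 = (c * a * c^-1) * (c * b * c^-1))%g.
Proof. by rewrite !mulgA mulgVK. Qed.

(** Conjugation by [c] followed by [phi] is again a positive homomorphism on [D], so uniqueness
    makes it a multiple of [phi]. *)
Lemma phi_conj c a : D a -> phi (c * a * c^-1)%g = dilation c * phi a.
Proof.
move=> Da; apply: (hoelder_map_unique least_convex_subgroup least_convex_u u1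
  least_convex_le D_ge (chi := fun a => phi (c * a * c^-1)%g)) => //.
  by move=> b d Db Dd; rewrite conj_mul phiM//; exact: least_convex_conj.
move=> b Db b1; apply: phi_gt0; first exact: least_convex_conj.
by have := germ_conj_lt c b1; rewrite mulg1 mulgV.
Qed.

Lemma dilation_gt0 c : 0 < dilation c.
Proof.
apply: phi_gt0; first exact/least_convex_conj/least_convex_u.
by have := germ_conj_lt c u1; rewrite mulg1 mulgV.
Qed.

Lemma dilationM c d : dilation (c * d)%g = dilation c * dilation d.
Proof.
rewrite /dilation -[phi (d * _ * _)%g]/(dilation d) -phi_conj.
  by rewrite invgM !mulgA.
exact/least_convex_conj/least_convex_u.
Qed.

(** * The action below the first common fixed point *)

Definition first_fix : R := inf [set x | 0 < x /\ forall c, act c x = x].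
Local Notation p := first_fix.

Let fix_lbound : has_lbound [set x | 0 < x /\ forall c, act c x = x].
Proof. by exists 0 => x [/ltW]. Qed.

Let fix1 : [set x | 0 < x /\ forall c, act c x = x] 1.
Proof. by split=> // c; rewrite act_at1. Qed.

Lemma first_fix_gt0 : 0 < p.
Proof.
have [d d0 ud] := u1; apply: (lt_le_trans d0).
apply: lb_le_inf; first by exists 1.
move=> x [x0 cx]; rewrite leNgt; apply/negP => xd.
by have := ud x; rewrite x0 xd act1 cx ltxx => /(_ isT).
Qed.

Lemma first_fix_fixed c : act c p = p.
Proof.
apply: act_inf; [by exists 1|exact: fix_lbound| |]; by move=> x [x0 cx]; rewrite cx.
Qed.

Lemma not_fixed x : 0 < x < p -> exists c, act c x <> x.
Proof.
move=> /andP[x0 xp]; apply: contrapT => allfix.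
have : p <= x.
  apply: ge_inf => //; split=> // c; apply: contrapT => cx.
  by apply: allfix; exists c.
by rewrite leNgt xp.
Qed.

Lemma act_in c x : 0 < x < p -> 0 < act c x < p.
Proof. by rewrite act_gt0 -{2}(first_fix_fixed c) act_lt. Qed.

(* A fixed set that is invariant under H has an infimum fixed by H, which stays
   away from 0 because fixed points of h do not accumulate there. *)
Lemma invariant_inf (A : set R) (H : set gT) h :
  h <> 1%g -> A `<=` [set x | 0 < x < p /\ act h x = x] -> A !=set0 ->
  (forall c, H c -> H c^-1%g) -> (forall c x, H c -> A x -> A (act c x)) ->
  exists2 y, 0 < y < p & forall c, H c -> act c y = y.
Proof.
move=> /eqP/(act_germ act)[d d0 hd] AI [x Ax] HV HA.
have Al : lbound A d.
  move=> y /AI[/andP[y0 _] hy]; rewrite leNgt; apply/negP => yd.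
  by have := hd y; rewrite y0 yd hy eqxx => /(_ isT).
have A0 : A !=set0 by exists x.
exists (inf A) => [|c Hc].
  rewrite (lt_le_trans d0) ?lb_le_inf//=.
  have [/andP[_ xp] _] := AI x Ax.
  by apply: le_lt_trans xp; apply: ge_inf => //; exists d.
by apply: act_inf => // [|y|y]; [exists d|exact: HA|exact/HA/HV].
Qed.

Lemma u_neq1 : u <> 1%g.
Proof. by move=> uE; apply: (@germ_lt_irr _ _ act 1%g); rewrite -{2}uE. Qed.

(** By normality the common fixed set of [D] is invariant under the whole group, so its infimum
    would be a common fixed point below [p]. *)
Lemma least_convex_not_fixed x : 0 < x < p -> exists2 a, D a & act a x <> x.
Proof.
move=> xI; apply: contrapT => allfix.
have Dx a : D a -> act a x = x.
  by move=> Da; apply: contrapT => ax; apply: allfix; exists a.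
have [||//||y yI fixy] := @invariant_inf
    [set x | 0 < x < p /\ forall a, D a -> act a x = x] setT u u_neq1.
- by move=> y [yI Dy]; split=> //; exact/Dy/least_convex_u.
- by exists x.
- move=> c y _ [yI Dy]; split=> [|a Da]; first exact: act_in.
  have := Dy _ (least_convex_conj c^-1%g Da); rewrite invgK !actM => {2}<-.
  by rewrite actVK.
have [c] := not_fixed yI; apply; exact: fixy.
Qed.

(** The fixed set of [c] is [D]-invariant, so its infimum would be fixed by [D]. *)
Lemma centralizer_free c x : c <> 1%g -> (forall a, D a -> (a * c = c * a)%g) ->
  0 < x < p -> act c x <> x.
Proof.
move=> c1 cD xI cx.
have [||||y yI fixy] := @invariant_inf [set x | 0 < x < p /\ act c x = x] D c c1.
- by [].
- by exists x.
- exact: DV.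
- by move=> a y Da [yI cy]; split; [exact: act_in|rewrite -actM -cD// actM cy].
by have [a Da] := least_convex_not_fixed yI; apply; exact: fixy.
Qed.

Lemma free_up c : 1%g <g c -> (forall x, 0 < x < p -> act c x <> x) ->
  forall x, 0 < x < p -> x < act c x.
Proof.
move=> [d d0 cd] free; have nf x : 0 < x < p -> act c x != x by move=> /free/eqP.
have [//|down] := act_const_sign nf.
have m0 : 0 < Num.min d p by rewrite lt_min d0 first_fix_gt0.
have : Num.min d p / 2 < Num.min d p by lra.
rewrite lt_min => /andP[xd xp]; set y := _ / 2 in xd xp.
have y0 : 0 < y by rewrite divr_gt0.
have := cd y; rewrite y0 xd act1 => /(_ isT) lt1.
by have := down y; rewrite y0 xp ltNge ltW// => /(_ isT).
Qed.

Lemma free_unbounded c x y : (forall x, 0 < x < p -> x < act c x) ->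
  0 < x < p -> 0 < y < p -> exists n, y < act (c ^+ n)%g x.
Proof.
move=> up /andP[x0 xp] /andP[y0 yp]; apply: act_escape => z /andP[xz zy].
by apply: up; rewrite (lt_le_trans x0 xz) (le_lt_trans zy yp).
Qed.

Local Notation x0 := (p / 2).

Lemma x0_in : 0 < x0 < p.
Proof. by have := first_fix_gt0; lra. Qed.

(** The images of [x0] determine the order of germs, which is therefore Archimedean; Hoelder's map
    on the whole group gives translations. *)
Lemma affine_rep_free : (forall c x, c <> 1%g -> 0 < x < p -> act c x <> x) ->
  exists lam tau : gT -> R, affine_rep lam tau.
Proof.
move=> free.
have le_of a b : act a x0 < act b x0 -> a <=g b.
  move=> ab; have [//|ba] := germ_leVgt act a b.
  have ba1 : 1%g <g (b^-1 * a)%g by have := germ_ltMl b^-1%g ba; rewrite mulVg.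
  have ba_neq : (b^-1 * a)%g <> 1%g.
    by move=> E; move: ba1; rewrite E; exact: germ_lt_irr.
  have := free_up ba1 (fun x => free _ x ba_neq) x0_in.
  by rewrite actM lt_actV ltNge ltW.
have arch v a : 1%g <g v -> exists n, a <=g (v ^+ n)%g.
  move=> v1; have v_neq : v <> 1%g by move=> E; move: v1; rewrite E; exact: germ_lt_irr.
  have [n /le_of] := free_unbounded (free_up v1 (fun x => free v x v_neq)) x0_in (act_in a x0_in).
  by exists n.
have subT : subgroup [set: gT] by split=> [|x y _ _]; apply: mem_set.
have arch_le a (_ : [set: gT] a) : exists n, a <=g (u ^+ n)%g := arch u a u1.
have arch_ge a (_ : [set: gT] a) (a1 : 1%g <g a) : exists n, u <=g (a ^+ n)%g := arch a u a1.
exists (fun=> 1), phi; split=> // [c d|c d|c _ c0]; first by rewrite mulr1.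
  by rewrite mul1r addrC (hoelder_mapM subT (I : setT u) u1 arch_le arch_ge).
apply: (hoelder_map_inj subT (I : setT u) u1 arch_le arch_ge) => //.
have := hoelder_mapM subT (I : setT u) u1 arch_le arch_ge (I : setT 1%g) (I : setT 1%g).
by rewrite mulg1 c0; lra.
Qed.

(** A dilation below 1 would have powers, values of [phi] at conjugates of [u], tending to 0. So all
    dilations are 1 and [D] is central. *)
Lemma affine_rep_discrete e : 0 < e -> (forall a, D a -> 1%g <g a -> e <= phi a) ->
  exists lam tau : gT -> R, affine_rep lam tau.
Proof.
move=> e0 gap.
have dilation1 : dilation 1%g = 1 by rewrite /dilation mul1g invg1 mulg1 phi_u.
have dilationX c n : dilation (c ^+ n)%g = dilation c ^+ n.
  by elim: n => [|n IH]; rewrite ?expg0 ?expr0// expgS dilationM IH exprS.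
have dil_ge c : 1 <= dilation c.
  rewrite leNgt; apply/negP => c1.
  have [n ne] : exists n, dilation c ^+ n < e.
    have c1' : `|dilation c| < 1 by rewrite gtr0_norm ?dilation_gt0.
    have /cvgrPdist_lt /(_ e e0)[n _ /(_ n (leqnn n))] := cvg_expr c1'.
    by rewrite sub0r normrN ger0_norm ?exprn_ge0 ?ltW ?dilation_gt0//; exists n.
  have := gap _ (least_convex_conj (c ^+ n)%g least_convex_u).
  rewrite -/(dilation _) dilationX leNgt ne => /(_ _)/negP[]//.
  by have := germ_conj_lt (c ^+ n)%g u1; rewrite mulg1 mulgV.
have dil1 c : dilation c = 1.
  apply/eqP; rewrite eq_le dil_ge andbT.
  have : dilation c * dilation c^-1%g = 1 by rewrite -dilationM mulgV.
  by have := dil_ge c^-1%g; have := dil_ge c; nra.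
apply: affine_rep_free => c x c1 xI; apply: centralizer_free => // a Da.
have : phi (c * a * c^-1)%g = phi a by rewrite phi_conj// dil1 mul1r.
move=> /(phi_inj (least_convex_conj c Da) Da) E.
by rewrite -{1}E mulgVK.
Qed.

(** * The developing map when the image of [phi] is dense *)

Section Dense.
Hypothesis dense : forall e, 0 < e -> exists a, [/\ D a, 1%g <g a & phi a < e].

Lemma phi_dense s t : s < t -> exists2 a, D a & s < phi a < t.
Proof.
move=> st; have [|b [Db b1 be]] := dense (e := t - s); first lra.
have b0 := phi_gt0 Db b1.
have phiZ m : phi (zpow b m) = phi b * m%:~R := additiveZ least_convex_subgroup m phiM Db.
(* The first multiple of [phi b] beyond s. *)
exists (zpow b (Num.floor (s / phi b) + 1)); first exact: DZ.
rewrite phiZ; have := floor_itv (s / phi b).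
rewrite ler_pdivlMr// ltr_pdivrMr// intrD mulr1z => /andP[lo hi].
by apply/andP; split; nra.
Qed.

(** The supremum of a bounded orbit of [D] would be fixed by [D]. *)
Lemma orbit_above y : 0 < y < p -> exists2 a, D a & y < act a x0.
Proof.
move=> /andP[y0 yp]; apply: contrapT => bnd.
pose A := [set act a x0 | a in D].
have Au : ubound A y.
  by move=> _ [a Da <-]; rewrite leNgt; apply/negP => ya; apply: bnd; exists a.
have D1 : D 1%g by exact: subgroup1 least_convex_subgroup.
have A0 : A !=set0 by exists x0, 1%g; rewrite ?act1.
have sA : sup A <= y by exact: ge_sup.
have xs : x0 <= sup A by apply: ub_le_sup; [exists y|exists 1%g; rewrite ?act1].
have [|a Da] := @least_convex_not_fixed (sup A).
  by have /andP[x00 _] := x0_in; rewrite (lt_le_trans x00 xs) (le_lt_trans sA yp).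
apply; apply: act_sup => //; first by exists y.
  by move=> _ [b Db <-]; exists (a * b)%g; [exact: DM|rewrite actM].
by move=> _ [b Db <-]; exists (a^-1 * b)%g; [apply: DM => //; exact: DV|rewrite actM].
Qed.

Lemma orbit_below y : 0 < y < p -> exists2 a, D a & act a x0 <= y.
Proof.
move=> /andP[y0 yp]; apply: contrapT => bnd.
pose A := [set act a x0 | a in D].
have Al : lbound A y.
  move=> _ [a Da <-]; rewrite leNgt; apply/negP => ya; apply: bnd; exists a => //.
  exact: ltW.
have D1 : D 1%g by exact: subgroup1 least_convex_subgroup.
have A0 : A !=set0 by exists x0, 1%g; rewrite ?act1.
have sA : y <= inf A by exact: lb_le_inf.
have xs : inf A <= x0 by apply: ge_inf; [exists y|exists 1%g; rewrite ?act1].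
have [|a Da] := @least_convex_not_fixed (inf A).
  by have /andP[_ x0p] := x0_in; rewrite (lt_le_trans y0 sA) (le_lt_trans xs x0p).
apply; apply: act_inf => //; first by exists y.
  by move=> _ [b Db <-]; exists (a * b)%g; [exact: DM|rewrite actM].
by move=> _ [b Db <-]; exists (a^-1 * b)%g; [apply: DM => //; exact: DV|rewrite actM].
Qed.

(** [D] is abelian, hence acts freely, so its order can be read off at [x0]. *)
Lemma orbit_lt a b : D a -> D b -> act a x0 < act b x0 -> a <g b.
Proof.
move=> Da Db ab; have [E|//|ba] := germ_total act a b; first by rewrite E ltxx in ab.
have ba1 : 1%g <g (b^-1 * a)%g by have := germ_ltMl b^-1%g ba; rewrite mulVg.
have ba_neq : (b^-1 * a)%g <> 1%g.
  by move=> E; move: ba1; rewrite E; exact: germ_lt_irr.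
have Dba : D (b^-1 * a)%g by apply: DM => //; exact: DV.
have := free_up ba1 (fun x => @centralizer_free _ x ba_neq
  (fun c Dc => least_convex_comm Dc Dba)) x0_in.
by rewrite actM lt_actV ltNge ltW.
Qed.

(** A monotone map from (0, p) to the line that turns the action of [D] into translations by
    [phi]. *)
Definition develop y := sup [set phi a | a in [set a | D a /\ act a x0 <= y]].

Lemma develop_le y a : 0 < y < p -> D a -> y < act a x0 -> develop y <= phi a.
Proof.
move=> yI Da ya; apply: ge_sup.
  by have [b Db yb] := orbit_below yI; exists (phi b), b.
move=> _ [b [Db yb] <-]; apply/ltW/phi_lt => //.
by apply: orbit_lt => //; exact: le_lt_trans ya.
Qed.

Lemma develop_ge y a : 0 < y < p -> D a -> act a x0 <= y -> phi a <= develop y.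
Proof.
move=> yI Da ya; apply: ub_le_sup; last by exists a.
have [b Db yb] := orbit_above yI; exists (phi b) => _ [c [Dc yc] <-].
apply/ltW/phi_lt => //; apply: orbit_lt => //.
exact: le_lt_trans yb.
Qed.

Lemma develop_unique y t : 0 < y < p ->
  (forall a, D a -> act a x0 <= y -> phi a <= t) ->
  (forall a, D a -> y < act a x0 -> t <= phi a) -> develop y = t.
Proof.
move=> yI le ge; have [lt|lt|//] := ltgtP (develop y) t.
  have [a Da /andP[lo hi]] := phi_dense lt.
  have [ay|ya] := leP (act a x0) y; first by have := develop_ge yI Da ay; lra.
  by have := ge a Da ya; lra.
have [a Da /andP[lo hi]] := phi_dense lt.
have [ay|ya] := leP (act a x0) y; first by have := le a Da ay; lra.
by have := develop_le yI Da ya; lra.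
Qed.

Lemma developM a y : D a -> 0 < y < p -> develop (act a y) = phi a + develop y.
Proof.
move=> Da yI; have shift b : D b -> phi (a^-1 * b)%g = phi b - phi a.
  by move=> Db; rewrite (phiM (DV Da) Db) (phiV Da) addrC.
have Dab b : D b -> D (a^-1 * b)%g by move=> Db; apply: DM => //; exact: DV.
apply: develop_unique => [|b Db|b Db]; first exact: act_in.
  rewrite -actV_le -actM => /(develop_ge yI (Dab b Db)).
  by rewrite shift//; lra.
rewrite -lt_actV => lt; have := develop_le yI (Dab b Db); rewrite actM => /(_ lt).
by rewrite shift//; lra.
Qed.

Lemma develop_homo y z : 0 < y < p -> 0 < z < p -> y <= z -> develop y <= develop z.
Proof.
move=> yI zI yz; apply: ge_sup.
  by have [b Db yb] := orbit_below yI; exists (phi b), b.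
by move=> _ [b [Db yb] <-]; apply: develop_ge => //; exact: le_trans yz.
Qed.

Definition translation c := develop (act c x0).

(** On the orbit of [x0] write c a x0 = (c a c^-1) c x0; density and monotonicity extend the formula
    to all y. *)
Lemma develop_act c y : 0 < y < p ->
  develop (act c y) = dilation c * develop y + translation c.
Proof.
move=> yI; have lam0 := dilation_gt0 c; have cyI := act_in c yI.
have cx0I := act_in c x0_in; have conjD a := least_convex_conj c (a := a).
have conj_dev a : D a -> develop (act c (act a x0)) = dilation c * phi a + translation c.
  move=> Da; have -> : act c (act a x0) = act (c * a * c^-1)%g (act c x0).
    by rewrite !actM actK.
  by rewrite developM ?phi_conj//; exact: conjD.
apply/eqP; rewrite eq_le; apply/andP; split.
  rewrite leNgt; apply/negP => lt.
  have [|a Da /andP[lo hi]] :=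
      @phi_dense (develop y) ((develop (act c y) - translation c) / dilation c).
    by rewrite ltr_pdivlMr//; lra.
  rewrite ltr_pdivlMr// in hi.
  have ya : y < act a x0.
    by rewrite ltNge; apply/negP => /(develop_ge yI Da); lra.
  have := develop_homo cyI (act_in c (act_in a x0_in)) (ltW (act_homo act c ya)).
  by rewrite conj_dev//; lra.
suff : develop y <= (develop (act c y) - translation c) / dilation c.
  by rewrite ler_pdivlMr//; lra.
apply: ge_sup; first by have [b Db yb] := orbit_below yI; exists (phi b), b.
move=> _ [a [Da ay] <-]; rewrite ler_pdivlMr//.
have := develop_homo (act_in c (act_in a x0_in)) cyI.
by rewrite act_le => /(_ ay); rewrite conj_dev//; lra.
Qed.

(** A kernel element commutes with [D]; if it is not 1, it acts freely, and a power of it or of its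
    inverse moves [x0] beyond u x0, forcing a translation of at least 1. *)
Lemma affine_rep_dense : affine_rep dilation translation.
Proof.
have tauM c d : translation (c * d)%g = dilation c * translation d + translation c.
  by rewrite /translation actM develop_act//; exact/act_in/x0_in.
split=> //; [exact: dilation_gt0|exact: dilationM|].
move=> c lam1 tau0; apply: contrapT => c1.
have cD a : D a -> (a * c = c * a)%g.
  move=> Da; have : phi (c * a * c^-1)%g = phi a by rewrite phi_conj// lam1 mul1r.
  by move=> /(phi_inj (least_convex_conj c Da) Da) E; rewrite -{1}E mulgVK.
suff main v : 1%g <g v -> v <> 1%g -> (forall a, D a -> (a * v = v * a)%g) ->
    dilation v = 1 -> translation v = 0 -> False.
  have tau1 : translation 1%g = 0.
    have := tauM 1%g 1%g; rewrite mulg1 /dilation mul1g invg1 mulg1 phi_u; lra.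
  have dil1 : dilation 1%g = 1 by rewrite /dilation mul1g invg1 mulg1 phi_u.
  have [//|lt|lt] := germ_total act c 1%g; last exact: (main c).
  apply: (main c^-1%g).
  - by have := germ_ltV lt; rewrite invg1.
  - by move=> E; apply: c1; rewrite -[c]invgK E invg1.
  - by move=> a Da; apply: (@mulgI _ c); rewrite mulVKg mulgA -cD// mulgK.
  - by have := dilationM c c^-1%g; rewrite mulgV lam1 dil1 mul1r.
  - by have := tauM c c^-1%g; rewrite mulgV tau1 lam1 tau0; lra.
move=> v1 v_neq vD lamv tauv.
have tauX n : translation (v ^+ n)%g = 0.
  elim: n => [|n IH]; last by rewrite expgS tauM IH lamv tauv; lra.
  have := tauM 1%g 1%g; rewrite mulg1 expg0 /dilation mul1g invg1 mulg1 phi_u; lra.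
have up := free_up v1 (fun x => @centralizer_free v x v_neq vD).
have [n lt] := free_unbounded up x0_in (act_in u x0_in).
have := develop_ge (act_in (v ^+ n)%g x0_in) least_convex_u (ltW lt).
by rewrite phi_u -/(translation _) tauX; lra.
Qed.

End Dense.

Lemma affine_rep_exists : exists lam tau : gT -> R, affine_rep lam tau.
Proof.
have [dense|] := pselect (forall e, 0 < e -> exists a, [/\ D a, 1%g <g a & phi a < e]).
  by exists dilation, translation; exact: affine_rep_dense.
move=> /existsNP[e /not_implyP[e0 none]]; apply: (affine_rep_discrete e0) => a Da a1.
by rewrite leNgt; apply/negP => ae; apply: none; exists a.
Qed.

End MinimalGerm.

Lemma affine_or_no_short_relation (R : realType) (gT : groupType) (act : germ_action R gT)
    K (t : 'I_K -> gT) :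
  (exists lam tau : gT -> R, affine_rep lam tau) \/
  (forall n, exists s : (bool + 'I_K)%type -> gT, no_short_relation n s /\
    forall H : set gT, subgroup H -> range s `<=` H -> range t `<=` H).
Proof.
have [nontriv|triv] := pselect (exists g, germ_lt act 1%g g); last first.
  (* With no positive germ the group is trivial. *)
  left; exists (fun=> 1), (fun=> 0); split=> //; first by move=> *; rewrite mulr1.
    by move=> *; rewrite mulr0 addr0.
  move=> c _ _; have [//|lt|lt] := germ_total act c 1%g; case: triv; last by exists c.
  by exists c^-1%g; have := germ_ltV lt; rewrite invg1.
have [[u [u1 u_min]]|nomin] := pselect
    (exists u, germ_lt act 1%g u /\ forall a, germ_ll act a u -> a = 1%g).
  by left; exact: affine_rep_exists u1 u_min.
right=> n; apply: (@no_short_relation_exists _ _ act) => // g g1.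
apply: contrapT => none; apply: nomin; exists g; split=> // a ag.
by apply: contrapT => a1; apply: none; exists a.
Qed.

(** * The action of a group of diffeomorphisms *)

Section SubgroupType.
Variables (gT : groupType) (G : set gT).

(** The proof is a parameter so that the type determines its group structure. *)
Definition subgroup_type (_ : subgroup G) := {x : gT | x \in mem G}.

Variable G_sub : subgroup G.
HB.instance Definition _ := SubChoice.copy (subgroup_type G_sub) {x : gT | x \in mem G}.
HB.instance Definition _ := SubChoice_isSubGroup.Build gT (mem G) (subgroup_type G_sub) G_sub.

End SubgroupType.

Section ExtendByIdentity.
Variable R : realType.
Implicit Types (f : unitI R -> unitI R) (g : bij_group (unitI R)) (x y : R).

Definition extend f x : R := if insub x is Some y then \val (f y) else x.

Lemma unitI_itv (y : unitI R) : 0 <= \val y <= 1.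
Proof. by have /set_mem := valP y; rewrite /unitI/= in_itv. Qed.

Lemma unitI_pt x : 0 <= x <= 1 -> exists y : unitI R, \val y = x.
Proof.
move=> x01; have xI : x \in unitI R by apply/mem_set; rewrite /unitI/= in_itv.
by exists (Sub x xI); rewrite SubK.
Qed.

Lemma extend_val f (y : unitI R) : extend f (\val y) = \val (f y).
Proof. by rewrite /extend valK. Qed.

Lemma extend_out f x : ~~ (0 <= x <= 1) -> extend f x = x.
Proof.
move=> x01; rewrite /extend insubN//; apply: contra x01 => /set_mem.
by rewrite /unitI/= in_itv.
Qed.

Lemma extend_itv f x : 0 <= x <= 1 -> 0 <= extend f x <= 1.
Proof. by move=> /unitI_pt[y <-]; rewrite extend_val; exact: unitI_itv. Qed.

Lemma extend_id x : extend id x = x.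
Proof. by rewrite /extend; case: insubP => // y _ ->. Qed.

Lemma extend_comp f f' x : extend (f \o f') x = extend f (extend f' x).
Proof.
have [/unitI_pt[y <-]|x01] := boolP (0 <= x <= 1); last by rewrite !extend_out.
by rewrite !extend_val.
Qed.

Lemma extend_homo f : (forall x y : unitI R, \val x < \val y -> \val (f x) < \val (f y)) ->
  forall x y, x < y -> extend f x < extend f y.
Proof.
move=> f_homo x y xy.
have [xI|xI] := boolP (0 <= x <= 1); have [yI|yI] := boolP (0 <= y <= 1).
- have [[x' xE] [y' yE]] := (unitI_pt xI, unitI_pt yI).
  by rewrite -xE -yE !extend_val f_homo// xE yE.
- have := extend_itv f xI; rewrite (extend_out _ yI); lra.
- have := extend_itv f yI; rewrite (extend_out _ xI); lra.
- by rewrite !extend_out.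
Qed.

Lemma extend_at0 g : Diff_plus R g -> extend g 0 = 0.
Proof.
move=> [_ _ g_homo]; have [w wE] : exists y : unitI R, \val y = 0.
  by apply: unitI_pt; lra.
have gV : g (g^-1%g w) = w by exact: bij_invK.
have /andP[V0 _] := unitI_itv (g^-1%g w).
have [V0'|V0'] := ltP 0 (\val (g^-1%g w)).
  rewrite -wE in V0'; have := g_homo _ _ V0'.
  rewrite gV wE.
  by have := unitI_itv (g w); lra.
have Vo : g^-1%g w = w by apply: val_inj; rewrite wE; apply/eqP; rewrite eq_le V0'.
by rewrite -{1}wE extend_val -{1}Vo gV wE.
Qed.

Lemma extend_at1 g : Diff_plus R g -> extend g 1 = 1.
Proof.
move=> [_ _ g_homo]; have [w wE] : exists y : unitI R, \val y = 1.
  by apply: unitI_pt; lra.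
have gV : g (g^-1%g w) = w by exact: bij_invK.
have /andP[_ V1] := unitI_itv (g^-1%g w).
have [V1'|V1'] := ltP (\val (g^-1%g w)) 1.
  rewrite -wE in V1'; have := g_homo _ _ V1'.
  rewrite gV wE.
  by have := unitI_itv (g w); lra.
have Vo : g^-1%g w = w by apply: val_inj; rewrite wE; apply/eqP; rewrite eq_le V1.
by rewrite -{1}wE extend_val -{1}Vo gV wE.
Qed.

Lemma seq_pos_lbound (s : seq R) : exists2 d, 0 < d & forall x, x \in s -> 0 < x -> d <= x.
Proof.
elim: s => [|a s [d d0 ds]]; first by exists 1.
have [a0|a0] := ltP 0 a.
  exists (Num.min a d); first by rewrite lt_min a0.
  move=> x; rewrite in_cons => /orP[/eqP->|xs] x0; first by rewrite ge_min lexx.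
  by rewrite ge_min ds ?orbT.
exists d => // x; rewrite in_cons => /orP[/eqP->|/ds//].
by rewrite ltNge a0.
Qed.

Lemma extend_germ g : finite_set [set x : unitI R | g x = x] ->
  exists2 d, 0 < d & forall x, 0 < x < d -> extend g x != x.
Proof.
move=> /finite_seqP[s sE].
(* All positive fixed points are at least [d]. *)
have [d d0 ds] := seq_pos_lbound [seq \val z | z : unitI R <- s].
exists (Num.min d 1); first by rewrite lt_min d0 ltr01.
move=> x; rewrite lt_min => /and3P[x0 xd x1]; apply/eqP.
have [|y yE] := @unitI_pt x; first by rewrite !ltW.
rewrite -yE extend_val => /val_inj gy.
have ys : y \in s by have : [set x : unitI R | g x = x] y by []; rewrite sE.
by have := ds x; rewrite -yE map_f// yE x0 leNgt xd => /(_ isT isT).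
Qed.

End ExtendByIdentity.

Section DiffAction.
Variables (R : realType) (G : set (bij_group (unitI R))).
Hypothesis G_sub : subgroup G.
Hypothesis G_Diff : G `<=` Diff_plus R.
Hypothesis G_fix : forall g, G g -> g <> 1%g -> finite_set [set x : unitI R | g x = x].
Local Notation gT := (subgroup_type G_sub).

Let GP (g : gT) : G (\val g). Proof. exact/set_mem/(valP g). Qed.

Definition diff_act (g : gT) : R -> R := extend (\val g : bij_group _).

Fact diff_act1 x : diff_act 1%g x = x.
Proof. exact: extend_id. Qed.

Fact diff_actM g h x : diff_act (g * h)%g x = diff_act g (diff_act h x).
Proof. exact: extend_comp. Qed.

Fact diff_act_homo g x y : x < y -> diff_act g x < diff_act g y.
Proof. by apply: extend_homo; have [] := G_Diff (GP g). Qed.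

Fact diff_act_germ g : g != 1%g ->
  exists2 d, 0 < d & forall x, 0 < x < d -> diff_act g x != x.
Proof.
move=> g1; apply/extend_germ/G_fix; first exact: GP.
by move=> gE; case/eqP: g1; apply: val_inj; rewrite gE.
Qed.

Definition diff_germ_action : germ_action R gT :=
  GermAction diff_act1 diff_actM diff_act_homo
    (fun g => extend_at0 (G_Diff (GP g))) (fun g => extend_at1 (G_Diff (GP g))) diff_act_germ.

End DiffAction.

(** * Embedding into the affine group *)

Section AffineImage.
Variables (R : realType) (gT : groupType) (G : set gT) (G_sub : subgroup G).
Variables (lam tau : subgroup_type G_sub -> R).
Hypothesis rep : affine_rep lam tau.
Implicit Types (c d : subgroup_type G_sub).

Let lam0 c : lam c != 0. Proof. by have [lam_gt0 _ _ _] := rep; rewrite gt_eqF. Qed.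

Fact affine_bijK c : cancel (fun x => lam c * x + tau c) (fun x => (x - tau c) / lam c).
Proof. by move=> x; rewrite addrK mulrAC divff ?mul1r. Qed.

Fact affine_bijVK c : cancel (fun x => (x - tau c) / lam c) (fun x => lam c * x + tau c).
Proof. by move=> x; rewrite mulrC divfK// subrK. Qed.

Definition affine_bij c : bij_group R := BijGroup (affine_bijK c) (affine_bijVK c).

(** One factor suffices; 1 is a default value outside [G]. *)
Definition affine_emb (x : gT) : {ffun 'I_1 -> bij_group R} :=
  if insub x is Some c then [ffun=> affine_bij c] else 1%g.

Lemma affine_embE c : affine_emb (\val c) = [ffun=> affine_bij c].
Proof. by rewrite /affine_emb valK. Qed.

Lemma affine_embedding : exists H : set {ffun 'I_1 -> bij_group R},
  [/\ subgroup H, H `<=` Aff_plus_pow R 1 & isomorphic G H].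
Proof.
have [lam_gt0 lamM tauM lam_inj] := rep.
have lift x : G x -> exists c : subgroup_type G_sub, \val c = x.
  by move=> Gx; exists (Sub x (mem_set Gx)); rewrite SubK.
have valG (c : subgroup_type G_sub) : G (\val c) by exact/set_mem/(valP c).
have embM (x y : gT) : G x -> G y -> affine_emb (x * y)%g = (affine_emb x * affine_emb y)%g.
  move=> /lift[c <-] /lift[d <-]; rewrite -valM !affine_embE.
  apply/ffunP => i; rewrite !ffunE; apply: bij_groupP => z /=.
  by rewrite lamM tauM mulrDr addrA mulrA.
have emb1 : affine_emb 1%g = 1%g.
  have G1 := subgroup1 G_sub.
  by apply: (@mulgI _ (affine_emb 1%g)); rewrite -embM// !mulg1.
have embV x : G x -> affine_emb x^-1%g = (affine_emb x)^-1%g.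
  move=> Gx; apply: (@mulgI _ (affine_emb x)).
  by rewrite -embM ?mulgV//; exact: subgroupV.
have emb_inj x : G x -> affine_emb x = 1%g -> x = 1%g.
  move=> /lift[c <-]; rewrite affine_embE => /ffunP/(_ ord0); rewrite !ffunE => E.
  (* The values at 0 and 1 give tau c = 0 and lam c = 1. *)
  have E0 := congr1 (fun h : bij_group R => h 0) E.
  have E1 := congr1 (fun h : bij_group R => h 1) E.
  rewrite /= mulr0 add0r in E0; rewrite /= mulr1 E0 addr0 in E1.
  by rewrite (lam_inj c).
exists (affine_emb @` G); split.
- split; first by apply/mem_set; exists 1%g => //; exact: subgroup1.
  move=> _ _ /set_mem[x Gx <-] /set_mem[y Gy <-]; apply/mem_set.
  exists (x * y^-1)%g; first by apply: subgroupM => //; exact: subgroupV.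
  by rewrite embM ?embV//; exact: subgroupV.
- move=> _ [x /lift[c <-] <-] i; rewrite affine_embE ffunE.
  by exists (lam c), (tau c).
exists affine_emb; split; first by move=> x y /set_mem Gx /set_mem Gy; exact: embM.
split=> [x Gx|x y /set_mem Gx /set_mem Gy xy|_ [x Gx <-]].
- by exists x.
- apply: divg1_eq; apply: emb_inj; first by apply: subgroupM => //; exact: subgroupV.
  by rewrite embM ?embV ?xy ?mulgV//; exact: subgroupV.
- by exists x.
Qed.

End AffineImage.

(** * From generators without short relations to infinite girth *)

Lemma girth_infinite (R : realType) (gT : groupType) (G : set gT) :
  (forall n, exists (I : finType) (s : I -> gT),
     no_short_relation n s /\ generated (range s) = G) ->
  group_girth R G = +oo%E.
Proof.
move=> gens; apply/eqyP => A A0.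
have [I [s [free gen]]] := gens (Num.trunc A).+1.
apply: le_trans (ereal_sup_ubound _); last first.
  exists (range s) => //; split=> //; exact: finite_image.
apply: le_trans (girth_no_short_relation R G free).
by rewrite lee_fin ltW// truncnS_gt.
Qed.

Theorem theorem1p1 (R : realType) (G : set (bij_group (unitI R)))
    (G_sub : subgroup G) (G_Diff : G `<=` Diff_plus R)
    (G_fg : finitely_generated G)
    (G_fix : forall g : bij_group (unitI R), G g -> g <> 1%g ->
       finite_set [set x : unitI R | g x = x]) :
  (exists n : nat, (1 <= n)%N /\
     exists H : set {ffun 'I_n -> bij_group R},
       [/\ subgroup H, H `<=` Aff_plus_pow R n & isomorphic G H])
  \/ group_girth R G = +oo%E.
Proof.
have [_ [/finite_seqP[l ->] genl]] := G_fg.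
have lG x : x \in l -> G x.
  move=> xl; rewrite -genl => H [_]; exact.
pose t (i : 'I_(size l)) : subgroup_type G_sub :=
  Sub (tnth (in_tuple l) i) (mem_set (lG _ (mem_tnth i (in_tuple l)))).
have [[lam [tau rep]]|free] :=
    affine_or_no_short_relation (diff_germ_action G_sub G_Diff G_fix) t.
  by left; exists 1%N; split=> //; exact: affine_embedding rep.
right; apply: girth_infinite => n; have [s [sfree sgen]] := free n.
exists (bool + 'I_(size l))%type, (\val \o s); split.
  by apply: no_short_relation_morph sfree; [exact: valM|exact: val_inj].
apply/seteqP; split.
  move=> x; apply; split=> // _ [i _ <-]; exact/set_mem/(valP (s i)).
move=> x Gx H [H_sub sH]; rewrite -genl in Gx; apply: Gx; split=> // y /= yl.
(* Pulled back to the subgroup type, [H] contains the new generators, hence the old ones [t]. *)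
pose H' : set (subgroup_type G_sub) := [set c | H (\val c)].
have H'_sub : subgroup H'.
  split; first exact/mem_set/(subgroup1 H_sub).
  move=> c d /set_mem Hc /set_mem Hd; apply/mem_set.
  exact: (subgroupM H_sub Hc (subgroupV H_sub Hd)).
have /sgen-/(_ _)tH' := H'_sub.
have yE : y = \val (t (Ordinal (etrans (index_mem y l) yl))).
  by rewrite SubK (tnth_nth y) /= nth_index.
rewrite yE; apply: tH'; last by eexists.
by move=> _ [i _ <-]; apply: sH; exists i.
Qed.
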